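(* There exists no quasiconformal tree $T$ such that every quasiconformal tree of valence at most $3$ quasisymmetrically embeds into $T$.
   Context: A metric tree is a compact, connected, locally connected metric space with at least two points in which any two points are joined by a unique arc. For $p$ in a metric tree $T$, the valence $\mathrm{val}(p,T)$ is the number of connected components of $T\setminus\{p\}$, and $\mathrm{val}(T)=\sup_{p\in T}\mathrm{val}(p,T)$. A metric space is doubling if there is $N\ge 1$ such that every ball can be covered by at most $N$ balls of half its radius; it is bounded turning if there is $C\ge1$ such that any two points $x,y$ can be joined by a continuum of diameter at most $C\,d(x,y)$. A quasiconformal tree is a metric tree that is doubling and bounded turning. A homeomorphism $f:X\to Y$ is quasisymmetric if there is a homeomorphism $\eta:[0,\infty)\to[0,\infty)$ with $d_Y(f(x),f(a))/d_Y(f(x),f(b))\le \eta\big(d_X(x,a)/d_X(x,b)\big)$ for all $x,a,b\in X$, $x\neq b$; a quasisymmetric embedding of $X$ into $Z$ is a quasisymmetric homeomorphism of $X$ onto a subset of $Z$. *)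

(* Defs.v *)
From Stdlib Require Import Reals Lra List.
Open Scope R_scope.

Record MetricSpace := {
  mcarrier :> Type;
  mdist : mcarrier -> mcarrier -> R;
  mdist_refl : forall x, mdist x x = 0;
  mdist_sep : forall x y, mdist x y = 0 -> x = y;
  mdist_sym : forall x y, mdist x y = mdist y x;
  mdist_tri : forall x y z, mdist x z <= mdist x y + mdist y z
}.

Arguments mdist {m} _ _.

Section MetricNotions.
Variable X : MetricSpace.

Definition ball (x : X) (r : R) : X -> Prop := fun y => mdist x y < r.

Definition is_open (U : X -> Prop) : Prop :=
  forall x, U x -> exists r, 0 < r /\ forall y, ball x r y -> U y.

Definition compact_set (A : X -> Prop) : Prop :=
  forall (I : Type) (U : I -> X -> Prop),
    (forall i, is_open (U i)) ->
    (forall x, A x -> exists i, U i x) ->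
    exists l : list I, forall x, A x -> exists i, In i l /\ U i x.

Definition connected_set (A : X -> Prop) : Prop :=
  ~ exists U V : X -> Prop,
      is_open U /\ is_open V /\
      (forall x, A x -> U x \/ V x) /\
      (exists x, A x /\ U x) /\ (exists x, A x /\ V x) /\
      (forall x, A x -> U x -> V x -> False).

Definition locally_connected : Prop :=
  forall (x : X) (U : X -> Prop), is_open U -> U x ->
    exists V, is_open V /\ connected_set V /\ V x /\ forall y, V y -> U y.

Definition continuum (E : X -> Prop) : Prop :=
  (exists x, E x) /\ compact_set E /\ connected_set E.

Definition diam_le (E : X -> Prop) (c : R) : Prop :=
  forall a b, E a -> E b -> mdist a b <= c.

Definition is_arc (A : X -> Prop) (x y : X) : Prop :=
  exists g : R -> X,
    g 0 = x /\ g 1 = y /\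
    (forall z, A z <-> exists t, 0 <= t <= 1 /\ g t = z) /\
    (forall s t, 0 <= s <= 1 -> 0 <= t <= 1 -> g s = g t -> s = t) /\
    (forall t eps, 0 <= t <= 1 -> 0 < eps -> exists delta, 0 < delta /\
       forall s, 0 <= s <= 1 -> Rabs (s - t) < delta -> mdist (g s) (g t) < eps) /\
    (forall t eps, 0 <= t <= 1 -> 0 < eps -> exists delta, 0 < delta /\
       forall s, 0 <= s <= 1 -> mdist (g s) (g t) < delta -> Rabs (s - t) < eps).

Definition metric_tree : Prop :=
  compact_set (fun _ => True) /\
  connected_set (fun _ => True) /\
  locally_connected /\
  (exists x y : X, x <> y) /\
  (forall x y : X, x <> y ->
     (exists A, is_arc A x y) /\
     (forall A B, is_arc A x y -> is_arc B x y -> forall z, A z <-> B z)).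

Definition doubling : Prop :=
  exists N : nat, (1 <= N)%nat /\
    forall (x : X) (r : R), 0 < r ->
      exists cs : list X, (length cs <= N)%nat /\
        forall y, ball x r y -> exists c, In c cs /\ ball c (r / 2) y.

Definition bounded_turning : Prop :=
  exists C : R, 1 <= C /\
    forall x y : X, exists E, continuum E /\ E x /\ E y /\ diam_le E (C * mdist x y).

Definition qc_tree : Prop := metric_tree /\ doubling /\ bounded_turning.

Definition same_comp_minus (p a b : X) : Prop :=
  exists E : X -> Prop, connected_set E /\ (forall z, E z -> z <> p) /\ E a /\ E b.

(* val(p,X) <= n : X \ {p} has at most n connected components, i.e. there are
   no n+1 points of X \ {p} lying in pairwise distinct components. *)
Definition valence_at_le (p : X) (n : nat) : Prop :=
  ~ exists f : nat -> X,
      (forall i, (i <= n)%nat -> f i <> p) /\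
      (forall i j, (i <= n)%nat -> (j <= n)%nat -> i <> j ->
         ~ same_comp_minus p (f i) (f j)).

Definition valence_le (n : nat) : Prop := forall p : X, valence_at_le p n.

End MetricNotions.

Definition homeo_nonneg (eta : R -> R) : Prop :=
  (forall t, 0 <= t -> 0 <= eta t) /\
  (forall s t, 0 <= s -> 0 <= t -> eta s = eta t -> s = t) /\
  (forall u, 0 <= u -> exists t, 0 <= t /\ eta t = u) /\
  (forall t eps, 0 <= t -> 0 < eps -> exists delta, 0 < delta /\
     forall s, 0 <= s -> Rabs (s - t) < delta -> Rabs (eta s - eta t) < eps) /\
  (forall t eps, 0 <= t -> 0 < eps -> exists delta, 0 < delta /\
     forall s, 0 <= s -> Rabs (eta s - eta t) < delta -> Rabs (s - t) < eps).

Definition qs_embedding (X Y : MetricSpace) (f : X -> Y) : Prop :=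
  (forall x y, f x = f y -> x = y) /\
  (forall x eps, 0 < eps -> exists delta, 0 < delta /\
     forall y, mdist x y < delta -> mdist (f x) (f y) < eps) /\
  (forall x eps, 0 < eps -> exists delta, 0 < delta /\
     forall y, mdist (f x) (f y) < delta -> mdist x y < eps) /\
  exists eta, homeo_nonneg eta /\
    forall x a b : X, x <> b ->
      mdist (f x) (f a) / mdist (f x) (f b) <= eta (mdist x a / mdist x b).

(* Main.v *)
(* A tree T satisfying the doubling condition bounds the number of long arcs that can leave a small
   set. Doubling and bounded turning refine chains at a uniform rate, so any two points x, y of T
   are joined by a path within 2C d(x,y) of x; the path contains an arc, hence the unique arc [x,y]
   stays that close to x. If n disjoint arcs leave a small set, points chosen on them at the same
   distance s from it are therefore s/C-separated, and doubling bounds n independently of the scale.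
   For n above that bound, a comb with ever tighter clusters of n teeth is a quasiconformal tree of
   valence at most 3; a quasisymmetric embedding sends a tight enough cluster to n such arcs,
   whatever its modulus is. *)
Require Import Defs.
From Stdlib Require Import Reals Lra Lia List Arith ZArith Classical ClassicalEpsilon ProofIrrelevance Cantor.
Open Scope R_scope.

(** The order of choices shapes the comb. [T] fixes the doubling and turning constants, these fix
    [n], and [n] fixes the comb; the embedding and its modulus come only afterwards. One comb must
    therefore hold clusters of every tightness, while its own doubling allows only boundedly many
    teeth comparable to a given scale near a point. One cluster of [n] teeth per power of 1/2, with
    teeth as tall as their distance from the origin, meets both demands. The teeth stand on distinct
    points of the spine, which keeps the valence at 3. The laborious step is that a path contains an
    arc. An arc is a homeomorphic image of [[0,1]], whereas a path obtained by refining chains may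
    rest, cross itself and fail to be rectifiable, so arc length cannot serve as parameter. Loops
    are cut out on the time axis, and a clock that advances exactly when the path moves makes the
    remaining path injective. *)

Ltac rabs := unfold Rabs in *; repeat destruct Rcase_abs; lra.

(** * Metric spaces and the real interval *)

Lemma mdist_pos (X : MetricSpace) (x y : X) : 0 <= mdist x y.
Proof.
  pose proof (mdist_tri X x y x) as H. rewrite mdist_refl, (mdist_sym X y x) in H. lra.
Qed.

Lemma mdist_gt0 (X : MetricSpace) (x y : X) : x <> y -> 0 < mdist x y.
Proof.
  intros H. destruct (mdist_pos X x y) as [|E]; [assumption|].
  destruct H. apply mdist_sep. now symmetry.
Qed.

Lemma ball_open (X : MetricSpace) (x : X) (r : R) : is_open X (ball X x r).
Proof.
  intros y Hy. unfold ball in *. exists (r - mdist x y). split; [lra|].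
  intros z Hz. pose proof (mdist_tri X x y z). lra.
Qed.

Definition R_metric : MetricSpace.
Proof.
  refine (@Build_MetricSpace R (fun x y => Rabs (x - y)) _ _ _ _); intros; rabs.
Defined.

Definition Rsup (E : R -> Prop) : R := epsilon (inhabits 0) (is_lub E).

Lemma Rsup_lub (E : R -> Prop) (b : R) :
  (forall x, E x -> x <= b) -> (exists x, E x) -> is_lub E (Rsup E).
Proof.
  intros Hb Hne. unfold Rsup. apply epsilon_spec.
  destruct (completeness E) as [m Hm]; [now exists b|assumption|now exists m].
Qed.

Lemma nat_floor (t : R) : 0 <= t -> exists n, INR n <= t < INR n + 1.
Proof.
  intros Ht. destruct (archimed t) as [H1 H2].
  assert (Hz : (0 <= up t - 1)%Z) by (assert (0 < up t)%Z by (apply lt_IZR; lra); lia).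
  exists (Z.to_nat (up t - 1)). rewrite INR_IZR_INZ, Z2Nat.id, minus_IZR by assumption. lra.
Qed.

Lemma half_pow_small (eps : R) : 0 < eps -> exists k, (/ 2) ^ k < eps.
Proof.
  intros He. destruct (pow_lt_1_zero (/ 2)) with (y := eps) as [k Hk]; [rabs|lra|].
  exists k. specialize (Hk k (le_n k)). rewrite Rabs_pos_eq in Hk; [assumption|].
  apply pow_le. lra.
Qed.

Lemma least_nat (P : nat -> Prop) (n : nat) :
  P n -> exists m, P m /\ forall k, P k -> (m <= k)%nat.
Proof.
  intros Hn. apply NNPP. intros HN.
  assert (H : forall m, ~ P m); [|now apply (H n)].
  intros m. induction m as [m IH] using lt_wf_ind. intros Hm. apply HN.
  exists m. split; [assumption|]. intros k Hk.
  destruct (le_lt_dec m k); [assumption|]. now destruct (IH k).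
Qed.

(** The supremum of the points up to which [P] holds throughout satisfies [P] itself, and the second
    hypothesis prevents it from being smaller than [b]. Compactness and connectedness of intervals
    are both drawn from this. *)
Lemma real_induction (a b : R) (P : R -> Prop) :
  (a <= b -> P a) ->
  (forall t, a <= t < b -> P t -> exists d, 0 < d /\ forall s, t < s < t + d -> s <= b -> P s) ->
  (forall t, a < t <= b -> (forall s, a <= s < t -> P s) -> P t) ->
  forall t, a <= t <= b -> P t.
Proof.
  intros H0 Hstep Hlim t Ht.
  set (E := fun u => a <= u <= b /\ forall s, a <= s <= u -> P s).
  assert (Ea : E a).
  { split; [lra|]. intros s Hs. replace s with a by lra. apply H0. lra. }
  destruct (completeness E) as [m [Hub Hm]].
  { exists b. intros u [Hu _]. lra. }
  { now exists a. }
  assert (Ham : a <= m) by now apply Hub.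
  assert (Hmb : m <= b) by (apply Hm; intros u [Hu _]; lra).
  assert (Hbelow : forall s, a <= s < m -> P s).
  { intros s Hs. apply NNPP. intros HN.
    assert (m <= s); [|lra]. apply Hm. intros u [Hu Hall].
    destruct (Rle_lt_dec u s); [assumption|]. destruct HN. apply Hall. lra. }
  assert (HPm : P m).
  { destruct (Req_dec a m) as [<-|Hne]; [apply H0; lra|]. apply Hlim; [lra|assumption]. }
  destruct (Req_dec m b) as [->|Hne].
  { destruct (Req_dec t b) as [->|]; [assumption|]. apply Hbelow. lra. }
  destruct (Hstep m) as [d [Hd Hs]]; [lra|assumption|].
  assert (E (Rmin b (m + d / 2))) as HE.
  { pose proof (Rmin_l b (m + d / 2)). pose proof (Rmin_r b (m + d / 2)).
    split.
    - split; [|assumption]. apply Rmin_glb; lra.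
    - intros s Hs'. destruct (Rtotal_order s m) as [?|[->|?]];
        [apply Hbelow; lra|assumption|apply Hs; lra]. }
  apply Hub in HE. unfold Rmin in HE. destruct Rle_dec; lra.
Qed.

(** This is compactness of [[a,b]] in a form without covers. With [P A] read as: finitely many
    members cover [A], or: one [delta] serves all of [A], it yields finite subcovers, positive
    distances and uniform moduli alike. *)
Lemma interval_local_global (a b : R) (P : (R -> Prop) -> Prop) :
  a <= b ->
  (forall A B : R -> Prop, (forall s, A s -> B s) -> P B -> P A) ->
  (forall A B : R -> Prop, P A -> P B -> P (fun s => A s \/ B s)) ->
  (forall v, a <= v <= b -> exists r, 0 < r /\ P (fun s => a <= s <= b /\ Rabs (s - v) < r)) ->
  P (fun s => a <= s <= b).
Proof.
  intros Hab Hmono Hun Hloc.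
  apply (real_induction a b (fun v => P (fun s => a <= s <= v))); [| | |lra].
  - intros _. destruct (Hloc a) as [r [Hr HP]]; [lra|].
    revert HP. apply Hmono. intros s Hs. split; [lra|rabs].
  - intros t Ht HP. destruct (Hloc t) as [r [Hr HP']]; [lra|].
    exists r. split; [assumption|]. intros u Hu Hub.
    apply Hmono with (B := fun s => a <= s <= t \/ (a <= s <= b /\ Rabs (s - t) < r)).
    + intros s Hs. destruct (Rle_lt_dec s t); [left; lra|right; split; [lra|rabs]].
    + now apply Hun.
  - intros t Ht HP. destruct (Hloc t) as [r [Hr HP']]; [lra|].
    apply Hmono with (B := fun s => a <= s <= Rmax a (t - r / 2) \/ (a <= s <= b /\ Rabs (s - t) < r)).
    + intros s Hs. unfold Rmax. destruct Rle_dec; destruct (Rle_lt_dec s (t - r / 2));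
        try (left; lra); right; split; try lra; rabs.
    + apply Hun; [|assumption]. apply HP. unfold Rmax. destruct Rle_dec; lra.
Qed.

Lemma interval_connected (U V : R -> Prop) :
  (forall t, 0 <= t <= 1 -> U t \/ V t) ->
  (forall t, 0 <= t <= 1 -> U t -> exists d, 0 < d /\ forall s, 0 <= s <= 1 -> Rabs (s - t) < d -> U s) ->
  (forall t, 0 <= t <= 1 -> V t -> exists d, 0 < d /\ forall s, 0 <= s <= 1 -> Rabs (s - t) < d -> V s) ->
  (forall t, 0 <= t <= 1 -> U t -> V t -> False) ->
  U 0 -> forall t, 0 <= t <= 1 -> U t.
Proof.
  intros Hc HU HV Hd H0. apply real_induction; [easy| |].
  - intros t Ht Hu. destruct (HU t) as [d [Hd' Hs]]; [lra|assumption|].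
    exists d. split; [assumption|]. intros s Hs' Hs1. apply Hs; [lra|rabs].
  - intros t Ht Hs. destruct (Hc t) as [|Hv]; [lra|assumption|]. exfalso.
    destruct (HV t) as [d [Hd' Hn]]; [lra|assumption|].
    set (s := Rmax 0 (t - d / 2)).
    assert (0 <= s < t /\ t - d / 2 <= s) as [? ?] by (unfold s, Rmax; destruct Rle_dec; lra).
    apply (Hd s); [lra|now apply Hs|]. apply Hn; [lra|rabs].
Qed.

Definition path_continuous (X : MetricSpace) (g : R -> X) : Prop :=
  forall t eps, 0 <= t <= 1 -> 0 < eps -> exists delta, 0 < delta /\
    forall s, 0 <= s <= 1 -> Rabs (s - t) < delta -> mdist (g s) (g t) < eps.

Definition trace (X : MetricSpace) (g : R -> X) : X -> Prop :=
  fun z => exists t, 0 <= t <= 1 /\ g t = z.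

Lemma trace_connected (X : MetricSpace) (g : R -> X) :
  path_continuous X g -> connected_set X (trace X g).
Proof.
  intros Hg (U & V & HU & HV & Hc & (x & (t & Ht & <-) & Hx) & (y & (s & Hs & <-) & Hy) & Hd).
  assert (Hop : forall W, is_open X W -> forall t, 0 <= t <= 1 -> W (g t) ->
      exists d, 0 < d /\ forall s, 0 <= s <= 1 -> Rabs (s - t) < d -> W (g s)).
  { intros W HW v Hv Hwv. destruct (HW _ Hwv) as [r [Hr Hb]].
    destruct (Hg v r Hv Hr) as [d [Hd' Hs']]. exists d. split; [assumption|].
    intros w Hw Hw'. apply Hb. unfold ball. rewrite mdist_sym. now apply Hs'. }
  assert (Hc' : forall t, 0 <= t <= 1 -> U (g t) \/ V (g t)) by (intros v Hv; apply Hc; now exists v).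
  assert (Hd' : forall t, 0 <= t <= 1 -> U (g t) -> V (g t) -> False)
    by (intros v Hv; apply Hd; now exists v).
  destruct (Hc' 0) as [H0|H0]; [lra| |].
  - apply (Hd' s); [assumption| |assumption].
    apply (interval_connected (fun t => U (g t)) (fun t => V (g t))); auto.
  - apply (Hd' t); [assumption|assumption|].
    apply (interval_connected (fun t => V (g t)) (fun t => U (g t))); eauto.
    intros v Hv. destruct (Hc' v Hv); auto.
Qed.

Lemma trace_compact (X : MetricSpace) (g : R -> X) :
  path_continuous X g -> compact_set X (trace X g).
Proof.
  intros Hg I U HU Hc.
  destruct (interval_local_global 0 1
    (fun A => exists l : list I, forall s, A s -> exists i, In i l /\ U i (g s))) as [l Hl].
  - lra.
  - intros A B HAB [l Hl]. exists l. auto.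
  - intros A B [l Hl] [l' Hl']. exists (l ++ l'). intros s [Hs|Hs].
    + destruct (Hl s Hs) as [i [Hi Hi']]. exists i. split; [apply in_or_app; now left|assumption].
    + destruct (Hl' s Hs) as [i [Hi Hi']]. exists i. split; [apply in_or_app; now right|assumption].
  - intros v Hv. destruct (Hc (g v)) as [i Hi]; [now exists v|].
    destruct (HU i _ Hi) as [r [Hr Hb]]. destruct (Hg v r Hv Hr) as [d [Hd Hs]].
    exists d. split; [assumption|]. exists (i :: nil). intros s [Hs1 Hs2]. exists i.
    split; [now left|]. apply Hb. unfold ball. rewrite mdist_sym. now apply Hs.
  - exists l. intros x (t & Ht & <-). now apply Hl.
Qed.

Lemma path_ivt (h : R -> R) (c : R) :
  path_continuous R_metric h -> h 0 <= c <= h 1 -> exists t, 0 <= t <= 1 /\ h t = c.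
Proof.
  intros Hh Hc. apply NNPP. intros HN.
  assert (Hne : forall t, 0 <= t <= 1 -> h t <> c) by (intros t Ht E; apply HN; now exists t).
  apply (trace_connected R_metric h Hh).
  exists (fun y => y < c), (fun y => c < y). simpl. unfold trace.
  split; [intros x Hx; exists (c - x); split; [lra|unfold ball; simpl; intros; rabs]|].
  split; [intros x Hx; exists (x - c); split; [lra|unfold ball; simpl; intros; rabs]|].
  split; [intros x (t & Ht & <-); specialize (Hne t Ht); simpl in *; lra|].
  assert (H0 : h 0 <> c) by (apply Hne; lra). assert (H1 : h 1 <> c) by (apply Hne; lra).
  split; [exists (h 0); split; [exists 0; split; [lra|reflexivity]|lra]|].
  split; [exists (h 1); split; [exists 1; split; [lra|reflexivity]|lra]|].
  intros; lra.
Qed.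

(* Applied in both directions between a path and its monotone time change, this makes the
   reparametrised path a homeomorphism onto its trace. *)
Lemma fibre_continuity (X Y : MetricSpace) (a : R -> X) (b : R -> Y) :
  path_continuous X a -> path_continuous Y b ->
  (forall s t, 0 <= s <= 1 -> 0 <= t <= 1 -> a s = a t -> b s = b t) ->
  forall t eps, 0 <= t <= 1 -> 0 < eps -> exists delta, 0 < delta /\
    forall s, 0 <= s <= 1 -> mdist (a s) (a t) < delta -> mdist (b s) (b t) < eps.
Proof.
  intros Ha Hb Hab t eps Ht He.
  apply (interval_local_global 0 1 (fun A => exists delta, 0 < delta /\
    forall s, A s -> mdist (a s) (a t) < delta -> mdist (b s) (b t) < eps)).
  - lra.
  - intros A B HAB (d & Hd & H). exists d. auto.
  - intros A B (d & Hd & H) (d' & Hd' & H'). exists (Rmin d d').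
    pose proof (Rmin_l d d'). pose proof (Rmin_r d d').
    split; [now apply Rmin_glb_lt|]. intros s [Hs|Hs] Hlt; [apply H|apply H']; auto; lra.
  - intros v Hv. destruct (classic (a v = a t)) as [E|E].
    + destruct (Hb v eps Hv He) as (d & Hd & H). exists d. split; [assumption|].
      exists 1. split; [lra|]. intros s [Hs Hs'] _.
      rewrite <- (Hab v t Hv Ht E). now apply H.
    + apply mdist_gt0 in E. destruct (Ha v (mdist (a v) (a t) / 2) Hv) as (d & Hd & H); [lra|].
      exists d. split; [assumption|]. exists (mdist (a v) (a t) / 2). split; [lra|].
      intros s [Hs Hs'] Hlt. specialize (H s Hs Hs').
      pose proof (mdist_tri X (a v) (a s) (a t)). rewrite (mdist_sym X (a v) (a s)) in *. lra.
Qed.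

(** * Paths contain arcs *)

Lemma dependent_choice (A : Type) (P : A -> Prop) (Q : nat -> A -> A -> Prop) (a0 : A) :
  P a0 -> (forall n a, P a -> exists b, P b /\ Q n a b) ->
  exists f : nat -> A, f O = a0 /\ forall n, P (f n) /\ Q n (f n) (f (S n)).
Proof.
  intros H0 Hs.
  set (nx := fun n (a : {a | P a}) =>
    constructive_indefinite_description _ (Hs n (proj1_sig a) (proj2_sig a))).
  set (f := fix f n : {a | P a} := match n with
    | O => exist P a0 H0
    | S n => exist P (proj1_sig (nx n (f n))) (proj1 (proj2_sig (nx n (f n)))) end).
  exists (fun n => proj1_sig (f n)). split; [reflexivity|]. intros n.
  split; [apply proj2_sig|]. exact (proj2 (proj2_sig (nx n (f n)))).
Qed.

(** With [rat_radius], an enumeration through the Cantor pairing of the intervals of radius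
    [1/(k+1)] about [i/(k+1)], a countable base at the points of the half-line. The centres alone
    serve later as a dense sequence of times. *)
Definition rat_center (n : nat) : R := let (i, k) := of_nat n in INR i / INR (S k).
Definition rat_radius (n : nat) : R := let (i, k) := of_nat n in / INR (S k).

Lemma rational_interval (t eps : R) :
  0 <= t -> 0 < eps -> exists n, Rabs (t - rat_center n) < rat_radius n < eps.
Proof.
  intros Ht He. destruct (archimed_cor1 eps He) as [k [Hk Hk0]].
  destruct k as [|k]; [lia|]. clear Hk0. pose proof (lt_0_INR (S k) ltac:(lia)) as Hpos.
  destruct (nat_floor (t * INR (S k))) as [i Hi]; [apply Rmult_le_pos; lra|].
  exists (to_nat (i, k)). unfold rat_center, rat_radius. rewrite cancel_of_to. split; [|assumption].
  replace (t - INR i / INR (S k)) with ((t * INR (S k) - INR i) * / INR (S k)) by (field; lra).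
  pose proof (Rinv_0_lt_compat _ Hpos).
  rewrite Rabs_pos_eq by (apply Rmult_le_pos; lra).
  rewrite <- (Rmult_1_l (/ INR (S k))) at 2. apply Rmult_lt_compat_r; lra.
Qed.

Definition closed_in_R (F : R -> Prop) : Prop :=
  forall t, ~ F t -> exists r, 0 < r /\ forall s, Rabs (s - t) < r -> ~ F s.

Definition gap (F : R -> Prop) (a b : R) : Prop :=
  F a /\ F b /\ a < b /\ forall s, a < s < b -> ~ F s.

Lemma closed_pred (F : R -> Prop) (lo t : R) :
  closed_in_R F -> F lo -> lo <= t ->
  exists a, F a /\ lo <= a <= t /\ forall s, F s -> s <= t -> s <= a.
Proof.
  intros Hcl Hlo Hle.
  destruct (completeness (fun s => F s /\ s <= t)) as [a [Hub Hl]].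
  { exists t. intros s [_ H]. assumption. }
  { now exists lo. }
  assert (lo <= a) by now apply Hub.
  assert (a <= t) by (apply Hl; intros s [_ Hs]; assumption).
  exists a. split; [|split; [lra|intros s Hs Hst; now apply Hub]].
  apply NNPP. intros HN. destruct (Hcl a HN) as [r [Hr Hn]].
  assert (a <= a - r / 2); [|lra]. apply Hl. intros s [Hs Hst].
  destruct (Rle_lt_dec s (a - r / 2)); [assumption|]. assert (s <= a) by now apply Hub.
  destruct (Hn s); [rabs|assumption].
Qed.

Lemma closed_succ (F : R -> Prop) (hi t : R) :
  closed_in_R F -> F hi -> t <= hi ->
  exists b, F b /\ t <= b <= hi /\ forall s, F s -> t <= s -> b <= s.
Proof.
  intros Hcl Hhi Hle.
  destruct (closed_pred (fun s => F (- s)) (- hi) (- t)) as (a & Ha & Hb & Hc).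
  - intros s Hs. destruct (Hcl (- s) Hs) as [r [Hr H]]. exists r. split; [assumption|].
    intros u Hu. apply H. rabs.
  - now rewrite Ropp_involutive.
  - lra.
  - exists (- a). split; [assumption|]. split; [lra|]. intros s Hs Hts.
    assert (- s <= a); [|lra]. apply Hc; [now rewrite Ropp_involutive|lra].
Qed.

(* A skeleton keeps enough of the time interval to run through the path with the loops
   over its gaps cut out. *)
Definition skeleton (X : MetricSpace) (g : R -> X) (F : R -> Prop) : Prop :=
  closed_in_R F /\ (forall t, F t -> 0 <= t <= 1) /\ F 0 /\ F 1 /\
  forall a b, gap F a b -> g a = g b.

Lemma skeleton_interval (X : MetricSpace) (g : R -> X) :
  skeleton X g (fun t => 0 <= t <= 1).
Proof.
  split; [|split; [auto|split; [lra|split; [lra|]]]].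
  - intros t Ht. destruct (Rlt_le_dec t 0).
    + exists (- t). split; [lra|]. intros s Hs. rabs.
    + exists (t - 1). split; [lra|]. intros s Hs. rabs.
  - intros a b (Ha & Hb & Hab & Hn). destruct (Hn ((a + b) / 2)); lra.
Qed.

Lemma skeleton_cut (X : MetricSpace) (g : R -> X) (F : R -> Prop) (s t : R) :
  skeleton X g F -> F s -> F t -> s < t -> g s = g t ->
  skeleton X g (fun u => F u /\ ~ (s < u < t)).
Proof.
  intros (Hcl & Hsub & H0 & H1 & Hgap) Hs Ht Hst Hg.
  pose proof (Hsub s Hs). pose proof (Hsub t Ht).
  split; [|split; [|split; [|split]]].
  - intros u Hu. destruct (classic (F u)) as [HF|HF].
    + assert (s < u < t) by (apply NNPP; tauto). exists (Rmin (u - s) (t - u)).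
      pose proof (Rmin_l (u - s) (t - u)). pose proof (Rmin_r (u - s) (t - u)).
      split; [apply Rmin_glb_lt; lra|]. intros v Hv [_ Hn]. apply Hn. rabs.
    + destruct (Hcl u HF) as (r & Hr & H'). exists r. split; [assumption|].
      intros v Hv [Hv' _]. now apply (H' v).
  - intros u [Hu _]. auto.
  - split; [assumption|lra].
  - split; [assumption|lra].
  (* A gap of the smaller set lies on one side of [(s,t)], where it is a gap of [F], or it
     straddles; then its ends can only be [s] and [t], which both remain in the set. *)
  - intros a b ((Ha & Ha') & (Hb & Hb') & Hab & Hn).
    destruct (Rle_lt_dec b s) as [Hbs|Hbs].
    { apply Hgap. repeat split; auto. intros u Hu Hu'. apply (Hn u Hu). split; [assumption|lra]. }
    destruct (Rle_lt_dec t a) as [Hta|Hta].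
    { apply Hgap. repeat split; auto. intros u Hu Hu'. apply (Hn u Hu). split; [assumption|lra]. }
    assert (t <= b) by (apply Rnot_lt_le; intros ?; apply Hb'; lra).
    assert (a <= s) by (apply Rnot_lt_le; intros ?; apply Ha'; lra).
    assert (a = s).
    { apply NNPP; intros ?. apply (Hn s); [lra|]. split; [assumption|lra]. }
    assert (b = t).
    { apply NNPP; intros ?. apply (Hn t); [lra|]. split; [assumption|lra]. }
    now subst.
Qed.

(** Only the gap condition could be lost in the limit. A gap [(a,b)] of the intersection, shrunk by
    [r] at both ends, is compact and so already missed by some [F n]. The gap of [F n] around it has
    ends within [r] of [a] and [b], and continuity of [g] forces [g a = g b]. *)
Lemma skeleton_inter (X : MetricSpace) (g : R -> X) (F : nat -> R -> Prop) :
  path_continuous X g -> (forall n, skeleton X g (F n)) ->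
  (forall n t, F (S n) t -> F n t) -> skeleton X g (fun t => forall n, F n t).
Proof.
  intros Hg HF Hdec.
  assert (Hle : forall m n t, (m <= n)%nat -> F n t -> F m t).
  { intros m n t Hmn. induction Hmn; auto. }
  split; [|split; [|split; [|split]]].
  - intros t Ht. apply not_all_ex_not in Ht. destruct Ht as [n Hn].
    destruct (HF n) as [Hcl _]. destruct (Hcl t Hn) as (r & Hr & H).
    exists r. split; [assumption|]. intros s Hs Hall. now apply (H s Hs).
  - intros t Ht. destruct (HF O) as (_ & Hsub & _). auto.
  - intros n. apply (HF n).
  - intros n. apply (HF n).
  - intros a b (Ha & Hb & Hab & Hn). apply NNPP. intros Hne. apply mdist_gt0 in Hne.
    set (d := mdist (g a) (g b)) in *.
    destruct (HF O) as (_ & Hsub & _).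
    pose proof (Hsub a (Ha O)). pose proof (Hsub b (Hb O)).
    destruct (Hg a (d / 2)) as (ra & Hra & Hga); [lra|lra|].
    destruct (Hg b (d / 2)) as (rb & Hrb & Hgb); [lra|lra|].
    set (r := Rmin (Rmin ra rb) (b - a) / 3).
    assert (0 < r /\ r < ra /\ r < rb /\ 3 * r <= b - a) as (Hr & Hrra & Hrrb & Hrab)
      by (unfold r, Rmin; repeat destruct Rle_dec; lra).
    destruct (interval_local_global (a + r) (b - r)
      (fun A => exists n, forall s, A s -> ~ F n s)) as [n Hfree].
    + lra.
    + intros A B HAB [n H']. exists n. auto.
    + intros A B [n H'] [n' H'']. exists (max n n'). intros s [Hs|Hs] Hs'.
      * apply (H' s Hs). revert Hs'. apply Hle. lia.
      * apply (H'' s Hs). revert Hs'. apply Hle. lia.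
    + intros v Hv. assert (Hv' : ~ forall n, F n v) by (apply Hn; lra).
      apply not_all_ex_not in Hv'. destruct Hv' as [n Hv'].
      destruct (HF n) as [Hcl _]. destruct (Hcl v Hv') as (e & He & H').
      exists e. split; [assumption|]. exists n. intros s [_ Hs]. now apply H'.
    + destruct (HF n) as (Hcl & _ & _ & _ & Hgap).
      destruct (closed_pred (F n) a ((a + b) / 2)) as (a' & Ha' & Hla & Hma); [assumption|apply Ha|lra|].
      destruct (closed_succ (F n) b ((a + b) / 2)) as (b' & Hb' & Hlb & Hmb); [assumption|apply Hb|lra|].
      assert (a' < a + r) by (apply Rnot_le_lt; intros ?; apply (Hfree a'); [lra|assumption]).
      assert (b - r < b') by (apply Rnot_le_lt; intros ?; apply (Hfree b'); [lra|assumption]).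
      assert (E : g a' = g b').
      { apply Hgap. repeat split; auto; [lra|]. intros s Hs Hs'.
        destruct (Rle_lt_dec s ((a + b) / 2)); [apply Hma in Hs'|apply Hmb in Hs']; lra. }
      specialize (Hga a' ltac:(lra) ltac:(rabs)). specialize (Hgb b' ltac:(lra) ltac:(rabs)).
      pose proof (mdist_tri X (g a) (g a') (g b)) as Htri. fold d in Htri.
      rewrite (mdist_sym X (g a)) in Htri. rewrite E in *. lra.
Qed.

(** A countable substitute for Zorn's lemma: running through the base intervals, each step passes to
    a smaller skeleton that avoids the current interval whenever there is one. If a point [u]
    strictly inside a loop survived, cutting out that loop at the stage of a small interval about
    [u] shows that the interval would have been removed. *)
Lemma minimal_skeleton (X : MetricSpace) (g : R -> X) :
  path_continuous X g -> exists F, skeleton X g F /\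
    forall s t u, F s -> F t -> g s = g t -> s < u < t -> ~ F u.
Proof.
  intros Hg.
  set (I := fun n s => Rabs (s - rat_center n) < rat_radius n).
  destruct (dependent_choice (R -> Prop) (skeleton X g)
    (fun n F G => (forall t, G t -> F t) /\
       forall H, skeleton X g H -> (forall t, H t -> F t) ->
         (forall s, I n s -> ~ H s) -> forall s, I n s -> ~ G s)
    (fun t => 0 <= t <= 1)) as (F & _ & HF).
  - apply skeleton_interval.
  - intros n F HF.
    destruct (classic (exists H, skeleton X g H /\ (forall t, H t -> F t) /\
      forall s, I n s -> ~ H s)) as [(H & H1 & H2 & H3)|HN].
    + exists H. auto.
    + exists F. split; [assumption|]. split; [auto|]. intros H H1 H2 H3.
      destruct HN. now exists H.
  - exists (fun t => forall n, F n t). split.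
    + apply skeleton_inter; [assumption|apply HF|]. intros n t. apply HF.
    + intros s t u Hs Ht E Hu Hu'.
      assert (0 <= u) by (destruct (HF O) as ((_ & Hsub & _) & _); apply Hsub, Hu').
      destruct (rational_interval u (Rmin (u - s) (t - u) / 2)) as [n Hn]; [assumption| |].
      { unfold Rmin; destruct Rle_dec; lra. }
      assert (Rmin (u - s) (t - u) <= u - s) by apply Rmin_l.
      assert (Rmin (u - s) (t - u) <= t - u) by apply Rmin_r.
      destruct (HF n) as (Hsk & _ & Hmin).
      apply (Hmin (fun v => F n v /\ ~ (s < v < t))) with (s := u); [|tauto| |apply Hn|apply Hu'].
      * apply skeleton_cut; auto. lra.
      * unfold I. intros v Hv [_ Hv']. apply Hv'. rabs.
Qed.

(** The path may rest but never returns to a point it has left: its fibres in [[0,1]] are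
    intervals. *)
Definition loop_free (X : MetricSpace) (g : R -> X) : Prop :=
  forall s t u, 0 <= s -> t <= 1 -> s <= u <= t -> g s = g t -> g u = g s.

(** [h] is [g] composed with the map [pr] to the last skeleton time before [t]. This map jumps over
    gaps, but [g] agrees at the two ends of each, so [h] is continuous; minimality of the skeleton
    forbids loops. *)
Lemma loop_erasure (X : MetricSpace) (g : R -> X) :
  path_continuous X g -> exists h, path_continuous X h /\ loop_free X h /\
    h 0 = g 0 /\ h 1 = g 1 /\ forall t, 0 <= t <= 1 -> trace X g (h t).
Proof.
  intros Hg. destruct (minimal_skeleton X g Hg) as (F & (Hcl & Hsub & H0 & H1 & Hgap) & Hmin).
  assert (Hpr : forall t, exists a, 0 <= t <= 1 ->
      F a /\ 0 <= a <= t /\ forall s, F s -> s <= t -> s <= a).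
  { intros t. destruct (classic (0 <= t <= 1)) as [Ht|Ht]; [|now exists 0].
    destruct (closed_pred F 0 t) as (a & Ha); [assumption|assumption|lra|]. now exists a. }
  set (pr := fun t => proj1_sig (constructive_indefinite_description _ (Hpr t))).
  assert (Hp : forall t, 0 <= t <= 1 -> F (pr t) /\ 0 <= pr t <= t /\
      forall s, F s -> s <= t -> s <= pr t)
    by (intros t; exact (proj2_sig (constructive_indefinite_description _ (Hpr t)))).
  clearbody pr. clear Hpr.
  assert (Hmono : forall s t, 0 <= s -> s <= t -> t <= 1 -> pr s <= pr t).
  { intros s t Hs Hst Ht. apply Hp; [lra|apply Hp; lra|]. destruct (Hp s) as (_ & ? & _); lra. }
  (* Two times are joined in the skeleton by points lying between them. *)
  assert (Hbetween : forall s t, 0 <= s -> s <= t -> t <= 1 ->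
      g (pr s) = g (pr t) \/ exists v w, s <= v <= t /\ s <= w <= t /\
        g (pr s) = g v /\ g (pr t) = g w).
  { intros s t Hs Hst Ht. destruct (Hp s) as (Fs & Bs & Ms); [lra|].
    destruct (Hp t) as (Ft & Bt & Mt); [lra|].
    destruct (Rle_lt_dec (pr t) s) as [Hle|Hlt].
    { left. f_equal. apply Rle_antisym; [now apply Hmono|now apply Ms]. }
    right. destruct (closed_succ F (pr t) s) as (v & Fv & Bv & Mv); [assumption|assumption|lra|].
    exists v, (pr t). repeat split; try lra.
    destruct (Req_dec (pr s) v) as [->|Hne]; [reflexivity|].
    apply Hgap. repeat split; auto; [lra|]. intros u Hu Fu.
    destruct (Rle_lt_dec u s); [apply Ms in Fu|apply Mv in Fu]; lra. }
  exists (fun t => g (pr t)). split; [|split; [|split; [|split]]].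
  - intros t eps Ht He. destruct (Hg t (eps / 2) Ht) as (d & Hd & Hc); [lra|].
    exists d. split; [assumption|]. intros s Hs Hst.
    assert (Hclose : forall v w, 0 <= v <= 1 -> 0 <= w <= 1 -> Rabs (v - t) < d ->
        Rabs (w - t) < d -> mdist (g v) (g w) < eps).
    { intros v w Hv Hw Hvt Hwt. pose proof (Hc v Hv Hvt). pose proof (Hc w Hw Hwt).
      pose proof (mdist_tri X (g v) (g t) (g w)). rewrite (mdist_sym X (g t)) in *. lra. }
    destruct (Rle_lt_dec s t) as [Hle|Hlt].
    + destruct (Hbetween s t) as [->|(v & w & Hv & Hw & -> & ->)]; try lra.
      * now rewrite mdist_refl.
      * apply Hclose; try lra; rabs.
    + destruct (Hbetween t s) as [->|(v & w & Hv & Hw & -> & ->)]; try lra.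
      * now rewrite mdist_refl.
      * apply Hclose; try lra; rabs.
  - intros s t u Hs Ht Hu E.
    destruct (Hp s) as (Fs & _); [lra|]. destruct (Hp t) as (Ft & _); [lra|].
    destruct (Hp u) as (Fu & _); [lra|].
    assert (pr s <= pr u) by (apply Hmono; lra). assert (pr u <= pr t) by (apply Hmono; lra).
    destruct (Req_dec (pr s) (pr u)) as [->|]; [reflexivity|].
    destruct (Req_dec (pr u) (pr t)) as [->|]; [now symmetry|].
    destruct (Hmin (pr s) (pr t) (pr u)); auto. lra.
  - f_equal. destruct (Hp 0) as (_ & ? & _); lra.
  - f_equal. destruct (Hp 1) as (_ & ? & M); [lra|]. apply M in H1; lra.
  - intros t Ht. exists (pr t). destruct (Hp t Ht) as (_ & ? & _). split; [lra|reflexivity].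
Qed.

(** * Time change of a loop-free path *)

Fixpoint dyadic_partial (a : nat -> R) (N : nat) : R :=
  match N with O => 0 | S n => dyadic_partial a n + (/ 2) ^ n * a n end.

Definition dyadic_sum (a : nat -> R) : R := Rsup (fun y => exists N, y = dyadic_partial a N).

Lemma dyadic_partial_le (a b : nat -> R) (c : R) (N : nat) :
  0 <= c -> (forall n, a n <= b n + c) -> dyadic_partial a N <= dyadic_partial b N + 2 * c.
Proof.
  intros Hc Hab.
  assert (dyadic_partial a N <= dyadic_partial b N + 2 * c * (1 - (/ 2) ^ N)).
  { induction N as [|N IH]; simpl; [lra|].
    assert (0 < (/ 2) ^ N) by (apply pow_lt; lra). specialize (Hab N).
    assert ((/ 2) ^ N * a N <= (/ 2) ^ N * (b N + c)) by (apply Rmult_le_compat_l; lra). lra. }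
  assert (0 < (/ 2) ^ N) by (apply pow_lt; lra). nra.
Qed.

Lemma dyadic_sum_lub (a : nat -> R) :
  (forall n, a n <= 1) -> is_lub (fun y => exists N, y = dyadic_partial a N) (dyadic_sum a).
Proof.
  intros Ha. apply Rsup_lub with (b := 2); [|now exists 0, O].
  intros y [N ->]. pose proof (dyadic_partial_le a (fun _ => 0) 1 N) as H.
  assert (E : dyadic_partial (fun _ => 0) N = 0)
    by (clear; induction N as [|N IH]; simpl; [reflexivity|rewrite IH; ring]).
  rewrite E in H. assert (forall n, a n <= 0 + 1) by (intros n; specialize (Ha n); lra).
  specialize (H ltac:(lra) ltac:(assumption)). lra.
Qed.

Lemma dyadic_sum_le (a b : nat -> R) (c : R) :
  0 <= c -> (forall n, a n <= 1) -> (forall n, b n <= 1) ->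
  (forall n, a n <= b n + c) -> dyadic_sum a <= dyadic_sum b + 2 * c.
Proof.
  intros Hc Ha Hb Hab. apply (dyadic_sum_lub a Ha). intros y [N ->].
  pose proof (dyadic_partial_le a b c N Hc Hab).
  assert (dyadic_partial b N <= dyadic_sum b) by (apply (dyadic_sum_lub b Hb); now exists N). lra.
Qed.

(** The surplus [d] of the [k]-th term persists in all later partial sums of [b]. As [a] is
    nonnegative its partial sums increase, so each of them may be compared at an index beyond
    [k]. *)
Lemma dyadic_sum_lt (a b : nat -> R) (k : nat) :
  (forall n, 0 <= a n <= 1) -> (forall n, b n <= 1) ->
  (forall n, a n <= b n) -> a k < b k -> dyadic_sum a < dyadic_sum b.
Proof.
  intros Ha Hb Hab Hk.
  assert (Hp : forall n, 0 < (/ 2) ^ n) by (intros; apply pow_lt; lra).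
  assert (Hs : forall n, (/ 2) ^ n * a n <= (/ 2) ^ n * b n).
  { intros n. apply Rmult_le_compat_l; [apply Rlt_le, Hp|apply Hab]. }
  set (d := (/ 2) ^ k * (b k - a k)). assert (0 < d) by (apply Rmult_lt_0_compat; [apply Hp|lra]).
  assert (Hgap : forall N, dyadic_partial a N + (if lt_dec k N then d else 0) <= dyadic_partial b N).
  { intros N. induction N as [|N IH]; cbn [dyadic_partial]; [destruct (lt_dec k 0); [lia|lra]|].
    specialize (Hs N). destruct (lt_dec k (S N)); destruct (lt_dec k N); try lia; try lra.
    replace N with k in * by lia. unfold d in *. lra. }
  assert (Hinc : forall N M, dyadic_partial a N <= dyadic_partial a (M + N)).
  { intros N M. induction M as [|M IH]; simpl; [lra|].
    assert (0 <= (/ 2) ^ (M + N) * a (M + N)%nat)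
      by (apply Rmult_le_pos; [apply Rlt_le, Hp|apply Ha]). lra. }
  assert (dyadic_sum a <= dyadic_sum b - d); [|lra].
  apply (dyadic_sum_lub a); [intros n; apply Ha|]. intros y [N ->].
  assert (dyadic_partial b (S k + N) <= dyadic_sum b)
    by (apply (dyadic_sum_lub b Hb); now eexists).
  specialize (Hgap (S k + N)%nat). specialize (Hinc N (S k)).
  destruct (lt_dec k (S k + N)); [lra|lia].
Qed.

Section TimeChange.
Variable X : MetricSpace.
Variable h : R -> X.

(* How far the path has strayed from [h q] since time [q]; truncated at 1 so that the weighted
   sum below converges. *)
Definition stray (q s : R) : R := Rmin 1 (mdist (h q) (h (Rmax q s))).

Definition max_stray (q t : R) : R := Rsup (fun y => exists s, 0 <= s <= t /\ y = stray q s).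

(** A clock for the path. A single [max_stray q] may stall while the path moves, for instance when
    it comes nearer to [h q] again; the sum over all rational [q] is constant exactly along the
    fibres of a loop-free [h]. *)
Definition progress (t : R) : R := dyadic_sum (fun n => max_stray (rat_center n) t).

Lemma stray_bounds (q s : R) : 0 <= stray q s <= 1.
Proof.
  unfold stray. pose proof (mdist_pos X (h q) (h (Rmax q s))).
  unfold Rmin. destruct Rle_dec; lra.
Qed.

Lemma max_stray_lub (q t : R) : 0 <= t ->
  is_lub (fun y => exists s, 0 <= s <= t /\ y = stray q s) (max_stray q t).
Proof.
  intros Ht. apply Rsup_lub with (b := 1).
  - intros y (s & _ & ->). apply stray_bounds.
  - exists (stray q 0), 0. split; [lra|reflexivity].
Qed.

Lemma stray_le_max (q s t : R) : 0 <= s <= t -> stray q s <= max_stray q t.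
Proof.
  intros Hs. apply (max_stray_lub q t); [lra|]. now exists s.
Qed.

Lemma max_stray_le (q t c : R) : 0 <= t ->
  (forall s, 0 <= s <= t -> stray q s <= c) -> max_stray q t <= c.
Proof.
  intros Ht Hc. apply (max_stray_lub q t Ht). intros y (s & Hs & ->). auto.
Qed.

Lemma max_stray_bounds (q t : R) : 0 <= t -> 0 <= max_stray q t <= 1.
Proof.
  intros Ht. pose proof (stray_bounds q 0). pose proof (stray_le_max q 0 t ltac:(lra)).
  split; [lra|]. apply max_stray_le; [assumption|]. intros; apply stray_bounds.
Qed.

Lemma max_stray_mono (q s t : R) : 0 <= s <= t -> max_stray q s <= max_stray q t.
Proof.
  intros Hs. apply max_stray_le; [lra|]. intros u Hu. apply stray_le_max. lra.
Qed.

Hypothesis h_cont : path_continuous X h.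

(** One [d] serves every [q], since the triangle inequality bounds the change of stray by the
    movement of the path alone. The weighted sum needs this uniformity. *)
Lemma stray_continuous (t eps : R) : 0 <= t <= 1 -> 0 < eps -> exists d, 0 < d /\
  forall q s, 0 <= s <= 1 -> Rabs (s - t) < d -> Rabs (stray q s - stray q t) <= eps.
Proof.
  intros Ht He. destruct (h_cont t (eps / 2) Ht) as (d & Hd & Hc); [lra|].
  exists d. split; [assumption|]. intros q s Hs Hst.
  assert (Hm : mdist (h (Rmax q s)) (h (Rmax q t)) <= eps).
  { assert (H0 : forall v w, 0 <= v <= 1 -> 0 <= w <= 1 -> Rabs (v - t) < d -> Rabs (w - t) < d ->
        mdist (h v) (h w) <= eps).
    { intros v w Hv Hw Hvt Hwt. pose proof (Hc v Hv Hvt). pose proof (Hc w Hw Hwt).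
      pose proof (mdist_tri X (h v) (h t) (h w)). rewrite (mdist_sym X (h t)) in *. lra. }
    unfold Rmax. destruct Rle_dec; destruct Rle_dec; try (apply H0; try lra; rabs).
    rewrite mdist_refl. lra. }
  unfold stray. pose proof (mdist_tri X (h q) (h (Rmax q s)) (h (Rmax q t))).
  pose proof (mdist_tri X (h q) (h (Rmax q t)) (h (Rmax q s))).
  rewrite (mdist_sym X (h (Rmax q t))) in *.
  unfold Rmin. do 2 destruct Rle_dec; rabs.
Qed.

Lemma max_stray_continuous (t eps : R) : 0 <= t <= 1 -> 0 < eps -> exists d, 0 < d /\
  forall q s, 0 <= s <= 1 -> Rabs (s - t) < d -> Rabs (max_stray q s - max_stray q t) <= 2 * eps.
Proof.
  intros Ht He. destruct (stray_continuous t eps Ht He) as (d & Hd & Hc).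
  exists d. split; [assumption|]. intros q s Hs Hst.
  assert (Hmain : forall v w, 0 <= v <= w -> w <= 1 -> Rabs (v - t) < d -> Rabs (w - t) < d ->
      (v = t \/ w = t) -> max_stray q w <= max_stray q v + 2 * eps).
  { intros v w Hv Hw Hvt Hwt Hor. apply max_stray_le; [lra|]. intros u Hu.
    destruct (Rle_lt_dec u v).
    - pose proof (stray_le_max q u v ltac:(lra)). lra.
    - pose proof (stray_le_max q v v ltac:(lra)).
      pose proof (Hc q u ltac:(lra) ltac:(rabs)). pose proof (Hc q v ltac:(lra) Hvt). rabs. }
  destruct (Rle_lt_dec s t).
  - pose proof (max_stray_mono q s t ltac:(lra)).
    specialize (Hmain s t ltac:(lra) ltac:(lra) Hst ltac:(rabs) ltac:(now right)). rabs.
  - pose proof (max_stray_mono q t s ltac:(lra)).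
    specialize (Hmain t s ltac:(lra) ltac:(lra) ltac:(rabs) Hst ltac:(now left)). rabs.
Qed.

Lemma progress_continuous : path_continuous R_metric progress.
Proof.
  intros t eps Ht He. destruct (max_stray_continuous t (eps / 8) Ht) as (d & Hd & Hc); [lra|].
  exists d. split; [assumption|]. intros s Hs Hst. simpl.
  assert (H : forall v w, 0 <= v -> 0 <= w ->
      (forall q, Rabs (max_stray q v - max_stray q w) <= 2 * (eps / 8)) ->
      progress v <= progress w + eps / 2).
  { intros v w Hv Hw Hvw. replace (eps / 2) with (2 * (2 * (eps / 8))) by field.
    apply dyadic_sum_le; [lra|intros; now apply max_stray_bounds..|].
    intros n. specialize (Hvw (rat_center n)). rabs. }
  assert (progress s <= progress t + eps / 2) by (apply H; [lra|lra|]; intros q; now apply Hc).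
  assert (progress t <= progress s + eps / 2)
    by (apply H; [lra|lra|]; intros q; rewrite Rabs_minus_sym; now apply Hc).
  rabs.
Qed.

Hypothesis h_loop_free : loop_free X h.

(** Loop-freeness makes [h] constant on [[s,t]], so no base time [q] sees new stray there. *)
Lemma progress_eq_of_path_eq (s t : R) :
  0 <= s -> s <= t -> t <= 1 -> h s = h t -> progress s = progress t.
Proof.
  intros Hs Hst Ht E. unfold progress.
  assert (H : forall q, max_stray q t = max_stray q s).
  { intros q. apply Rle_antisym; [|now apply max_stray_mono].
    apply max_stray_le; [lra|]. intros u Hu. destruct (Rle_lt_dec u s) as [|Hsu].
    - now apply stray_le_max.
    - apply Rle_trans with (stray q s); [|apply stray_le_max; lra].
      unfold stray. replace (h (Rmax q u)) with (h (Rmax q s)); [lra|].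
      unfold Rmax. destruct Rle_dec; destruct Rle_dec; try lra; try reflexivity.
      + symmetry. now apply (h_loop_free s t); try lra.
      + rewrite (h_loop_free s t u), (h_loop_free s t q); auto; lra. }
  pose proof (dyadic_sum_le (fun n => max_stray (rat_center n) s)
    (fun n => max_stray (rat_center n) t) 0) as H1.
  pose proof (dyadic_sum_le (fun n => max_stray (rat_center n) t)
    (fun n => max_stray (rat_center n) s) 0) as H2.
  assert (Hb : forall v, 0 <= v -> forall n, max_stray (rat_center n) v <= 1)
    by (intros v Hv n; now apply max_stray_bounds).
  specialize (H1 ltac:(lra) (Hb s ltac:(lra)) (Hb t ltac:(lra)) ltac:(intros n; cbv beta; rewrite H; lra)).
  specialize (H2 ltac:(lra) (Hb t ltac:(lra)) (Hb s ltac:(lra)) ltac:(intros n; cbv beta; rewrite H; lra)).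
  lra.
Qed.

(** A rational [q] so soon after [s] that [h q] differs from [h t] detects the motion: up to time
    [s] its stray is 0 because it has not started counting, and at [t] it is positive. *)
Lemma progress_lt (s t : R) :
  0 <= s -> s <= t -> t <= 1 -> h s <> h t -> progress s < progress t.
Proof.
  intros Hs Hst Ht Hne. pose proof (mdist_gt0 X _ _ Hne) as Hpos.
  assert (s < t) by (destruct Hst as [ | -> ]; [assumption|now destruct Hne]).
  destruct (h_cont s (mdist (h s) (h t)) ltac:(lra) Hpos) as (d & Hd & Hc).
  set (m := Rmin d (t - s)).
  assert (0 < m /\ m <= d /\ m <= t - s) as (Hm & Hmd & Hmt)
    by (unfold m, Rmin; destruct Rle_dec; lra).
  destruct (rational_interval (s + m / 2) (m / 2)) as [n Hn]; [lra|lra|].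
  set (q := rat_center n) in *.
  assert (Hq : s < q < t /\ q - s < d) by (split; rabs).
  apply dyadic_sum_lt with (k := n).
  - intros k. apply max_stray_bounds. lra.
  - intros k. apply max_stray_bounds. lra.
  - intros k. apply max_stray_mono. lra.
  - fold q. apply Rle_lt_trans with 0.
    + apply max_stray_le; [lra|]. intros u Hu. unfold stray.
      rewrite Rmax_left, mdist_refl by lra. apply Rmin_r.
    + apply Rlt_le_trans with (stray q t); [|apply stray_le_max; lra].
      unfold stray. rewrite Rmax_right by lra. apply Rmin_glb_lt; [lra|].
      apply mdist_gt0. intros E. specialize (Hc q ltac:(lra) ltac:(rabs)).
      rewrite E, mdist_sym in Hc. lra.
Qed.

End TimeChange.

(** The clock [p] and the loop-free path [h] have the same fibres. Hence [h] composed with a right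
    inverse [tau] of the rescaled clock is injective, and although [tau] may jump,
    [fibre_continuity] in its two directions makes the composition a homeomorphism onto its
    trace. *)
Lemma path_contains_arc (X : MetricSpace) (g : R -> X) :
  path_continuous X g -> g 0 <> g 1 ->
  exists A, is_arc X A (g 0) (g 1) /\ forall z, A z -> trace X g z.
Proof.
  intros Hg Hne. destruct (loop_erasure X g Hg) as (h & Hh & Hlf & E0 & E1 & Htr).
  rewrite <- E0, <- E1 in *. clear E0 E1.
  set (p := progress X h).
  assert (Hp : path_continuous R_metric p) by now apply progress_continuous.
  assert (Hhp : forall s t, 0 <= s <= 1 -> 0 <= t <= 1 -> h s = h t -> p s = p t).
  { intros s t Hs Ht E. destruct (Rle_lt_dec s t).
    - apply progress_eq_of_path_eq; auto; lra.
    - symmetry. apply progress_eq_of_path_eq; auto; lra. }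
  assert (Hph : forall s t, 0 <= s <= 1 -> 0 <= t <= 1 -> p s = p t -> h s = h t).
  { intros s t Hs Ht E. apply NNPP. intros N. destruct (Rle_lt_dec s t).
    - assert (p s < p t); [|lra]. apply progress_lt; auto; lra.
    - assert (p t < p s); [|lra]. apply progress_lt; auto; lra. }
  assert (Hmono : forall s t, 0 <= s -> s <= t -> t <= 1 -> p s <= p t).
  { intros s t Hs Hst Ht. destruct (classic (h s = h t)) as [E|N].
    - rewrite (Hhp s t); auto; lra.
    - left. now apply progress_lt. }
  assert (H01 : p 0 < p 1) by (apply progress_lt; auto; lra).
  assert (Hinv : forall u, exists t, 0 <= u <= 1 -> 0 <= t <= 1 /\ p t = p 0 + u * (p 1 - p 0)).
  { intros u. destruct (classic (0 <= u <= 1)) as [Hu|Hu]; [|now exists 0].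
    destruct (path_ivt p (p 0 + u * (p 1 - p 0)) Hp) as [t Ht]; [nra|]. now exists t. }
  apply choice in Hinv. destruct Hinv as [tau Htau].
  assert (Hpt : forall s t, 0 <= s <= 1 -> 0 <= t <= 1 ->
      p (tau s) - p (tau t) = (s - t) * (p 1 - p 0)).
  { intros s t Hs Ht. destruct (Htau s Hs) as [_ ->]. destruct (Htau t Ht) as [_ ->]. ring. }
  exists (trace X (fun u => h (tau u))). split.
  - exists (fun u => h (tau u)). split; [|split; [|split; [|split; [|split]]]].
    + destruct (Htau 0 ltac:(lra)) as [? ?]. apply Hph; lra.
    + destruct (Htau 1 ltac:(lra)) as [? ?]. apply Hph; lra.
    + intros z. reflexivity.
    + intros s t Hs Ht E. pose proof (Hpt s t Hs Ht) as H.
      rewrite (Hhp (tau s) (tau t)) in H; [|now apply Htau|now apply Htau|assumption]. nra.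
    + intros t eps Ht He.
      destruct (fibre_continuity R_metric X p h Hp Hh Hph (tau t) eps) as (d & Hd & Hc);
        [now apply Htau|assumption|].
      exists (d / (p 1 - p 0)). split; [apply Rdiv_lt_0_compat; lra|].
      intros s Hs Hst. apply Hc; [now apply Htau|]. simpl. rewrite Hpt by assumption.
      rewrite Rabs_mult, (Rabs_pos_eq (p 1 - p 0)) by lra.
      apply Rmult_lt_compat_r with (r := p 1 - p 0) in Hst; [|lra].
      replace (d / (p 1 - p 0) * (p 1 - p 0)) with d in Hst by (field; lra). assumption.
    + intros t eps Ht He.
      destruct (fibre_continuity X R_metric h p Hh Hp Hhp (tau t) (eps * (p 1 - p 0))) as (d & Hd & Hc);
        [now apply Htau|apply Rmult_lt_0_compat; lra|].
      exists d. split; [assumption|]. intros s Hs Hst. specialize (Hc (tau s) ltac:(now apply Htau) Hst).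
      simpl in Hc. rewrite Hpt, Rabs_mult, (Rabs_pos_eq (p 1 - p 0)) in Hc by lra.
      apply Rmult_lt_reg_r in Hc; [assumption|lra].
  - intros z (u & Hu & <-). apply Htr. now apply Htau.
Qed.

(** * Short arcs in doubling trees of bounded turning *)

Definition doubling_with (X : MetricSpace) (N : nat) : Prop :=
  forall (x : X) (r : R), 0 < r ->
    exists cs : list X, (length cs <= N)%nat /\
      forall y, ball X x r y -> exists c, In c cs /\ ball X c (r / 2) y.

Lemma doubling_iterate (X : MetricSpace) (N : nat) :
  doubling_with X N -> forall m (x : X) r, 0 < r ->
    exists cs : list X, (length cs <= N ^ m)%nat /\
      forall y, ball X x r y -> exists c, In c cs /\ ball X c (r * (/ 2) ^ m) y.
Proof.
  intros HN m. induction m as [|m IH]; intros x r Hr.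
  - exists (x :: nil). split; [simpl; lia|]. intros y Hy. exists x. split; [now left|].
    simpl. now rewrite Rmult_1_r.
  - destruct (HN x r Hr) as (cs & Hl & Hcs).
    assert (H : exists ds : list X, (length ds <= length cs * N ^ m)%nat /\
      forall y c, In c cs -> ball X c (r / 2) y ->
        exists d, In d ds /\ ball X d (r * (/ 2) ^ S m) y).
    { clear Hl Hcs. induction cs as [|c cs (ds & Hl & Hds)].
      - exists nil. split; [simpl; lia|]. intros y c [].
      - destruct (IH c (r / 2)) as (es & Hle & Hes); [lra|]. exists (es ++ ds).
        split; [rewrite length_app; simpl; lia|]. intros y c' [<-|Hc'] Hy.
        + destruct (Hes y Hy) as (e & He & Hb). exists e. split; [apply in_or_app; now left|].
          replace (r * (/ 2) ^ S m) with (r / 2 * (/ 2) ^ m) by (simpl; field). assumption.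
        + destruct (Hds y c' Hc' Hy) as (e & He & Hb). exists e.
          split; [apply in_or_app; now right|assumption]. }
    destruct H as (ds & Hld & Hds). exists ds. split.
    + simpl. apply Nat.le_trans with (1 := Hld). now apply Nat.mul_le_mono_r.
    + intros y Hy. destruct (Hcs y Hy) as (c & Hc & Hb). eauto.
Qed.

(** Pigeonhole: two points sharing one of the balls left after [m] halvings would be closer than
    twice its radius. *)
Lemma separated_points_bound (X : MetricSpace) (N m n : nat) (x : X) (r : R) (p : nat -> X) :
  doubling_with X N -> 0 < r -> (forall i, (i < n)%nat -> ball X x r (p i)) ->
  (forall i j, (i < j < n)%nat -> 2 * (r * (/ 2) ^ m) <= mdist (p i) (p j)) ->
  (n <= N ^ m)%nat.
Proof.
  intros HN Hr Hb Hsep. destruct (doubling_iterate X N HN m x r Hr) as (cs & Hl & Hcs).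
  assert (H : forall i, exists c, (i < n)%nat -> In c cs /\ ball X c (r * (/ 2) ^ m) (p i)).
  { intros i. destruct (lt_dec i n) as [Hi|Hi]; [|exists x; lia].
    destruct (Hcs (p i) (Hb i Hi)) as (c & Hc). now exists c. }
  apply choice in H. destruct H as [f Hf].
  assert (Hinj : forall i j, (i < j < n)%nat -> f i <> f j).
  { intros i j Hij E. destruct (Hf i) as [_ Hi]; [lia|]. destruct (Hf j) as [_ Hj]; [lia|].
    specialize (Hsep i j Hij). unfold ball in *. rewrite E in Hi.
    pose proof (mdist_tri X (p i) (f j) (p j)). rewrite (mdist_sym X (p i) (f j)) in *. lra. }
  rewrite <- (length_seq n 0), <- (length_map f). apply Nat.le_trans with (2 := Hl).
  apply NoDup_incl_length.
  - apply NoDup_map_NoDup_ForallPairs; [|apply seq_NoDup].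
    intros i j Hi Hj E. apply in_seq in Hi, Hj.
    destruct (lt_eq_lt_dec i j) as [[?|?]|?]; [|assumption|].
    + destruct (Hinj i j); auto; lia.
    + destruct (Hinj j i); auto; lia.
  - intros c Hc. apply in_map_iff in Hc. destruct Hc as (i & <- & Hi).
    apply in_seq in Hi. apply Hf. lia.
Qed.

Definition cauchy (X : MetricSpace) (u : nat -> X) : Prop :=
  forall eps, 0 < eps -> exists N, forall n m, (N <= n)%nat -> (N <= m)%nat -> mdist (u n) (u m) < eps.

Definition converges (X : MetricSpace) (u : nat -> X) (l : X) : Prop :=
  forall eps, 0 < eps -> exists N, forall n, (N <= n)%nat -> mdist (u n) l < eps.

Definition complete (X : MetricSpace) : Prop :=
  forall u, cauchy X u -> exists l, converges X u l.

(** Without a limit, the balls that [u] eventually avoids would cover the space, since a Cauchy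
    sequence that keeps entering every ball about [x] converges to [x]. A tail of [u] would then
    avoid a finite subcover. *)
Lemma compact_complete (X : MetricSpace) : compact_set X (fun _ => True) -> complete X.
Proof.
  intros Hc u Hu. apply NNPP. intros HN.
  destruct (Hc {c : X * R | exists N, forall n, (N <= n)%nat -> ~ ball X (fst c) (snd c) (u n)}
    (fun c => ball X (fst (proj1_sig c)) (snd (proj1_sig c)))) as [l Hl].
  - intros i. apply ball_open.
  - intros x _. apply NNPP. intros Hx. apply HN. exists x. intros eps He.
    destruct (Hu (eps / 2)) as [N Hn]; [lra|].
    exists N. intros n Hn'. apply NNPP. intros Hge. apply Hx.
    assert (Hex : exists N, forall m, (N <= m)%nat -> ~ ball X (fst (x, eps / 2)) (snd (x, eps / 2)) (u m)).
    { exists N. intros m Hm Hb. unfold ball in Hb. simpl in Hb.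
      pose proof (Hn n m Hn' Hm). pose proof (mdist_tri X (u n) (u m) x).
      rewrite (mdist_sym X x) in Hb. lra. }
    exists (exist _ (x, eps / 2) Hex). unfold ball. simpl. rewrite mdist_refl. lra.
  - assert (H : exists N, forall c, In c l -> forall n, (N <= n)%nat ->
      ~ ball X (fst (proj1_sig c)) (snd (proj1_sig c)) (u n)).
    { clear Hl. induction l as [|[c [N Hc']] l [M IH]]; [now exists O|].
      exists (max N M). intros d [<-|Hd] n Hn; [apply Hc'|apply IH]; auto; lia. }
    destruct H as [N HN']. destruct (Hl (u N) I) as (c & Hc1 & Hc2). now apply (HN' c Hc1 N).
Qed.

Lemma geometric_steps (X : MetricSpace) (u : nat -> X) (c : R) :
  (forall n, mdist (u n) (u (S n)) <= c * (/ 2) ^ n) ->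
  forall n k, mdist (u n) (u (k + n)%nat) <= 2 * c * ((/ 2) ^ n - (/ 2) ^ (k + n)).
Proof.
  intros Hu n k. induction k as [|k IH]; simpl.
  - rewrite mdist_refl. lra.
  - specialize (Hu (k + n)%nat). pose proof (mdist_tri X (u n) (u (k + n)%nat) (u (S (k + n)))). lra.
Qed.

Lemma geometric_limit (X : MetricSpace) (u : nat -> X) (c : R) :
  complete X -> (forall n, mdist (u n) (u (S n)) <= c * (/ 2) ^ n) ->
  exists l, forall n, mdist (u n) l <= 2 * c * (/ 2) ^ n.
Proof.
  intros HX Hu.
  assert (Hc : 0 <= c) by (specialize (Hu O); pose proof (mdist_pos X (u O) (u 1%nat)); simpl in Hu; lra).
  assert (Hp : forall n, 0 < (/ 2) ^ n) by (intros; apply pow_lt; lra).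
  assert (Hle : forall n m, (n <= m)%nat -> mdist (u n) (u m) <= 2 * c * (/ 2) ^ n).
  { intros n m Hnm. pose proof (geometric_steps X u c Hu n (m - n)) as H.
    rewrite Nat.sub_add in H by assumption. specialize (Hp m).
    assert (0 <= c * (/ 2) ^ m) by (apply Rmult_le_pos; lra).
    lra. }
  destruct (HX u) as [l Hl].
  - intros eps He. destruct (half_pow_small (eps / (4 * c + 1))) as [N HN]; [apply Rdiv_lt_0_compat; lra|].
    exists N. intros n m Hn Hm. pose proof (Hle N n Hn) as H1. pose proof (Hle N m Hm) as H2.
    pose proof (mdist_tri X (u n) (u N) (u m)). rewrite (mdist_sym X (u n) (u N)) in *.
    apply Rmult_lt_compat_r with (r := 4 * c + 1) in HN; [|lra].
    replace (eps / (4 * c + 1) * (4 * c + 1)) with eps in HN by (field; lra).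
    specialize (Hp N). lra.
  - exists l. intros n. apply Rle_plus_epsilon. intros e He. destruct (Hl e He) as [M HM].
    specialize (HM (max n M) ltac:(lia)). pose proof (Hle n (max n M) ltac:(lia)).
    pose proof (mdist_tri X (u n) (u (max n M)) l). lra.
Qed.

Definition is_chain (X : MetricSpace) (E : X -> Prop) (eps : R) (z : nat -> X) (k : nat) : Prop :=
  (forall i, (i <= k)%nat -> E (z i)) /\
  forall i, (i < k)%nat -> mdist (z i) (z (S i)) < eps.

(** If [y] were unreachable, the [eps]-neighbourhoods of the reachable and of the unreachable points
    of [E] would disconnect [E]: a point of [E] in both would make an unreachable point
    reachable. *)
Lemma connected_chain (X : MetricSpace) (E : X -> Prop) (eps : R) (x y : X) :
  connected_set X E -> 0 < eps -> E x -> E y ->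
  exists z k, is_chain X E eps z k /\ z O = x /\ z k = y.
Proof.
  intros HE He Hx Hy. apply NNPP. intros HN. apply HE.
  set (reach := fun w => exists z k, is_chain X E eps z k /\ z O = x /\ z k = w).
  assert (Hext : forall v w, reach v -> E w -> mdist v w < eps -> reach w).
  { intros v w (z & k & (H1 & H2) & H3 & H4) Hw Hvw.
    exists (fun i => if le_dec i k then z i else w), (S k). split; [split|split].
    - intros i Hi. destruct le_dec; auto.
    - intros i Hi. destruct (le_dec i k); [|lia]. destruct (le_dec (S i) k); [apply H2; lia|].
      replace i with k by lia. now rewrite H4.
    - destruct le_dec; [assumption|lia].
    - destruct le_dec; [lia|reflexivity]. }
  assert (Hr : forall v, reach v -> E v) by (intros v (z & k & (H1 & _) & _ & <-); now apply H1).
  assert (Hrx : reach x).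
  { exists (fun _ => x), O. repeat split; auto. intros i Hi. lia. }
  assert (Hop : forall Q : X -> Prop, is_open X (fun w => exists v, Q v /\ mdist v w < eps)).
  { intros Q w (v & Hv & Hvw). exists (eps - mdist v w). split; [lra|]. intros u Hu.
    exists v. split; [assumption|]. unfold ball in Hu. pose proof (mdist_tri X v w u). lra. }
  exists (fun w => exists v, reach v /\ mdist v w < eps),
    (fun w => exists v, (E v /\ ~ reach v) /\ mdist v w < eps).
  split; [apply Hop|]. split; [apply Hop|].
  assert (Hself : forall v : X, mdist v v < eps) by (intros v; rewrite mdist_refl; lra).
  split; [|split; [|split]].
  - intros v Hv. destruct (classic (reach v)); [left|right]; exists v; auto.
  - exists x. split; [assumption|]. now exists x.
  - exists y. split; [assumption|]. exists y. auto.
  - intros w Hw (v & Hv & Hvw) (v' & (Hv' & Hn) & Hvw'). apply Hn.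
    apply (Hext w); [now apply (Hext v)|assumption|]. now rewrite mdist_sym.
Qed.

Lemma shortest_chain (X : MetricSpace) (E : X -> Prop) (eps : R) (x y : X) :
  connected_set X E -> 0 < eps -> E x -> E y ->
  exists z k, is_chain X E eps z k /\ z O = x /\ z k = y /\
    forall i j, (i + 1 < j <= k)%nat -> eps <= mdist (z i) (z j).
Proof.
  intros HE He Hx Hy. destruct (connected_chain X E eps x y HE He Hx Hy) as (z0 & k0 & H0).
  destruct (least_nat (fun k => exists z, is_chain X E eps z k /\ z O = x /\ z k = y) k0)
    as (k & (z & (Hin & Hst) & H1 & H2) & Hmin); [now exists z0|].
  exists z, k. split; [now split|]. split; [assumption|]. split; [assumption|].
  intros i j Hij. apply Rnot_lt_le. intros Hlt.
  assert ((k <= k - (j - i - 1))%nat); [|lia]. apply Hmin.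
  (* The chain with the [j - i - 1] points between [z i] and [z j] skipped. *)
  exists (fun m => if le_dec m i then z m else z (m + (j - i - 1))%nat).
  split; [split|split].
  - intros m Hm. destruct le_dec; apply Hin; lia.
  - intros m Hm. destruct (le_dec m i); destruct (le_dec (S m) i); try lia.
    + apply Hst. lia.
    + replace m with i by lia. replace (S i + (j - i - 1))%nat with j by lia. assumption.
    + apply Hst. lia.
  - destruct le_dec; [assumption|lia].
  - destruct le_dec; [lia|]. now replace (k - (j - i - 1) + (j - i - 1))%nat with k by lia.
Qed.

Definition turning_with (X : MetricSpace) (C : R) : Prop :=
  forall x y : X, exists E, continuum X E /\ E x /\ E y /\ diam_le X E (C * mdist x y).

(* Every other point of a shortest chain is separated from the rest, so doubling bounds the number
   of points of the chain independently of the scale. *)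
Lemma uniform_subdivision (X : MetricSpace) (N : nat) (C : R) :
  (1 <= N)%nat -> doubling_with X N -> 1 <= C -> turning_with X C ->
  exists M, (2 <= M)%nat /\ forall a b : X, exists z : nat -> X,
    z O = a /\ z M = b /\
    (forall i, mdist (z i) (z (S i)) <= mdist a b / 2) /\
    (forall i, mdist a (z i) <= C * mdist a b).
Proof.
  (* The even-numbered chain points are [d/2] apart in a ball of radius [2 C d]; [m] halvings
     achieve [2 (2 C d) 2^-m <= d/2], hence the factor [8 C]. *)
  intros HN1 HN HC HT. destruct (half_pow_small (/ (8 * C))) as [m Hm]; [apply Rinv_0_lt_compat; lra|].
  assert (HNm : (1 <= N ^ m)%nat) by (pose proof (Nat.pow_nonzero N m); lia).
  exists (2 * N ^ m)%nat. split; [lia|]. intros a b.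
  destruct (classic (a = b)) as [<-|Hab].
  { exists (fun _ => a). rewrite !mdist_refl. repeat split; intros; lra. }
  apply mdist_gt0 in Hab. set (d := mdist a b) in *.
  assert (HCd : 0 < C * d) by (apply Rmult_lt_0_compat; lra).
  destruct (HT a b) as (E & (_ & _ & HE) & Ha & Hb & Hdiam). fold d in Hdiam.
  destruct (shortest_chain X E (d / 2) a b) as (z & k & (Hin & Hst) & Hz0 & Hzk & Hsep); auto; [lra|].
  pose proof (Nat.div_mod k 2 ltac:(lia)) as Hdm. pose proof (Nat.mod_upper_bound k 2 ltac:(lia)).
  assert (Hk : (k / 2 + 1 <= N ^ m)%nat).
  { apply (separated_points_bound X N m _ a (2 * (C * d)) (fun i => z (2 * i)%nat)); auto.
    - lra.
    - intros i Hi. assert (Hi' : (2 * i <= k)%nat) by lia.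
      specialize (Hdiam a (z (2 * i)%nat) Ha (Hin _ Hi')). unfold ball. lra.
    - intros i j Hij. apply Rle_trans with (d / 2); [|apply Hsep; lia].
      apply Rmult_lt_compat_r with (r := 8 * C) in Hm; [|lra].
      rewrite Rinv_l in Hm by lra. apply Rmult_lt_compat_r with (r := d) in Hm; lra. }
  (* Repeating the last point pads all chains to one length [M], independent of [a] and [b]. *)
  exists (fun i => z (Nat.min i k)). split; [assumption|]. split; [|split].
  - rewrite Nat.min_r; [assumption|]. lia.
  - intros i. destruct (le_lt_dec k i).
    + rewrite !Nat.min_r, mdist_refl by lia. lra.
    + rewrite !Nat.min_l by lia. left. now apply Hst.
  - intros i. apply Hdiam; [assumption|]. apply Hin. lia.
Qed.

Section Subdivision.
Variables (X : MetricSpace) (M : nat) (S_ : X -> X -> nat -> X) (a b : X).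

(** The points after [k] subdivisions, with relevant indices from 0 to [M^k]. At level 0 every index
    from 1 on gives [b], so the estimates for consecutive points hold for all [j] without a range
    condition. *)
Fixpoint level (k j : nat) : X :=
  match k with
  | O => match j with O => a | S _ => b end
  | S k => S_ (level k (j / M)) (level k (j / M + 1)) (j mod M)
  end.
End Subdivision.

Lemma INR_floor_div (M q p : nat) (t : R) :
  (0 < M)%nat -> INR q <= INR M * t < INR q + 1 -> INR p <= t < INR p + 1 -> (q / M = p)%nat.
Proof.
  intros HM Hq Hp. assert (0 < INR M) by now apply lt_0_INR.
  assert (H1 : (M * p < q + 1)%nat).
  { apply INR_lt. rewrite mult_INR, plus_INR. simpl. nra. }
  assert (H2 : (q < M * (p + 1))%nat).
  { apply INR_lt. rewrite mult_INR, plus_INR. simpl. nra. }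
  symmetry. apply Nat.div_unique with (q - M * p)%nat; lia.
Qed.

Lemma INR_floor_unique (p q : nat) (t : R) :
  INR q <= t < INR q + 1 -> INR p <= t < INR p + 1 -> q = p.
Proof.
  intros Hq Hp. pose proof (INR_floor_div 1 q p t). rewrite Nat.div_1_r in H.
  apply H; [lia|simpl; lra|assumption].
Qed.

(** [g t] is the limit over [k] of the level-[k] point whose index is the floor of [M^k t]. Passing
    to the next level moves a point by at most [C d 2^-k], which gives convergence and the distance
    bound; with the bound [d 2^-k] for steps within a level it also gives continuity. *)
Lemma turning_path (X : MetricSpace) (N : nat) (C : R) :
  complete X -> (1 <= N)%nat -> doubling_with X N -> 1 <= C -> turning_with X C ->
  forall a b : X, exists g, path_continuous X g /\ g 0 = a /\ g 1 = b /\
    forall t, 0 <= t <= 1 -> mdist a (g t) <= 2 * C * mdist a b.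
Proof.
  intros HX HN1 HN HC HT a b.
  destruct (uniform_subdivision X N C HN1 HN HC HT) as (M & HM & Hsub).
  assert (HS : exists S_ : X -> X -> nat -> X, forall a b,
    S_ a b O = a /\ S_ a b M = b /\
    (forall i, mdist (S_ a b i) (S_ a b (S i)) <= mdist a b / 2) /\
    (forall i, mdist a (S_ a b i) <= C * mdist a b)).
  { exists (fun a b => proj1_sig (constructive_indefinite_description _ (Hsub a b))).
    intros a' b'. exact (proj2_sig (constructive_indefinite_description _ (Hsub a' b'))). }
  destruct HS as [S_ HS]. clear Hsub. set (P := level X M S_ a b). set (d := mdist a b).
  assert (Hd : 0 <= d) by apply mdist_pos.
  assert (Hhalf : forall n, 0 < (/ 2) ^ n) by (intros; apply pow_lt; lra).
  assert (HP : forall k j, P (S k) j = S_ (P k (j / M)%nat) (P k (S (j / M))) (j mod M))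
    by (intros k j; unfold P; simpl; now rewrite Nat.add_1_r).
  assert (Hstep : forall k j, mdist (P k j) (P k (S j)) <= d * (/ 2) ^ k).
  { intros k. induction k as [|k IH]; intros j.
    - simpl. destruct j; simpl; [unfold d; lra|]. rewrite mdist_refl. lra.
    - rewrite !HP. specialize (IH (j / M)%nat).
      destruct (HS (P k (j / M)%nat) (P k (S (j / M)))) as (E0 & EM & Hs & _).
      specialize (Hs (j mod M)).
      pose proof (Nat.div_mod j M ltac:(lia)) as Hj. pose proof (Nat.mod_upper_bound j M ltac:(lia)).
      apply Rle_trans with (mdist (P k (j / M)%nat) (P k (S (j / M))) / 2); [|simpl; lra].
      (* If [j] is the last index of its block, [j + 1] opens the next block, whose first point is
         the end of this one. *)
      destruct (Nat.eq_dec (S (j mod M)) M) as [E|E].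
      + assert (Eq : (S j / M = S (j / M))%nat) by (symmetry; apply Nat.div_unique with O; lia).
        assert (Em : (S j mod M = 0)%nat) by (symmetry; apply Nat.mod_unique with (S (j / M)); lia).
        rewrite Eq, Em. destruct (HS (P k (S (j / M))) (P k (S (S (j / M))))) as (E0' & _).
        rewrite E0'. rewrite E, EM in Hs. assumption.
      + assert (Eq : (S j / M = j / M)%nat) by (symmetry; apply Nat.div_unique with (S (j mod M)); lia).
        assert (Em : (S j mod M = S (j mod M))%nat)
          by (symmetry; apply Nat.mod_unique with (j / M)%nat; lia).
        rewrite Eq, Em. assumption. }
  assert (Href : forall k j, mdist (P k (j / M)%nat) (P (S k) j) <= C * d * (/ 2) ^ k).
  { intros k j. rewrite HP. destruct (HS (P k (j / M)%nat) (P k (S (j / M)))) as (_ & _ & _ & Hr).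
    apply Rle_trans with (1 := Hr (j mod M)). rewrite Rmult_assoc.
    apply Rmult_le_compat_l; [lra|apply Hstep]. }
  assert (Hend : forall k, P k O = a /\ P k (M ^ k)%nat = b).
  { intros k. induction k as [|k [IH0 IH1]]; [split; reflexivity|]. rewrite !HP. split.
    - rewrite Nat.Div0.div_0_l, Nat.Div0.mod_0_l, IH0. apply HS.
    - simpl. rewrite Nat.mul_comm, Nat.div_mul, Nat.Div0.mod_mul, IH1 by lia. apply HS. }
  assert (Hfl : forall k, exists fl : R -> nat, forall t, 0 <= t ->
      INR (fl t) <= INR (M ^ k) * t < INR (fl t) + 1).
  { intros k. apply (choice (fun t n => 0 <= t -> INR n <= INR (M ^ k) * t < INR n + 1)).
    intros t. destruct (Rle_lt_dec 0 t) as [Ht|Ht]; [|exists O; lra].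
    destruct (nat_floor (INR (M ^ k) * t)) as [n Hn]; [apply Rmult_le_pos; [apply pos_INR|assumption]|].
    now exists n. }
  apply choice in Hfl. destruct Hfl as [fl Hfl].
  assert (Hlim : forall t, exists l, 0 <= t ->
      forall k, mdist (P k (fl k t)) l <= 2 * (C * d) * (/ 2) ^ k).
  { intros t. destruct (Rle_lt_dec 0 t) as [Ht|Ht]; [|exists a; lra].
    destruct (geometric_limit X (fun k => P k (fl k t)) (C * d) HX) as [l Hl]; [|now exists l].
    intros k. replace (P k (fl k t)) with (P k (fl (S k) t / M)%nat); [apply Href|].
    f_equal. apply INR_floor_div with (INR (M ^ k) * t); [lia| |now apply Hfl].
    specialize (Hfl (S k) t Ht). simpl in Hfl. rewrite mult_INR in Hfl. lra. }
  apply choice in Hlim. destruct Hlim as [g Hg].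
  assert (Huniq : forall t c, 0 <= t -> (forall k, P k (fl k t) = c) -> g t = c).
  { intros t c Ht Hc. symmetry. apply mdist_sep. apply Rle_antisym; [|apply mdist_pos].
    apply Rle_plus_epsilon. intros e He.
    destruct (half_pow_small (e / (2 * (C * d) + 1))) as [k Hk]; [apply Rdiv_lt_0_compat; nra|].
    specialize (Hg t Ht k). rewrite Hc in Hg.
    apply Rmult_lt_compat_r with (r := 2 * (C * d) + 1) in Hk; [|nra].
    replace (e / (2 * (C * d) + 1) * (2 * (C * d) + 1)) with e in Hk by (field; nra).
    specialize (Hhalf k). lra. }
  exists g. split; [|split; [|split]].
  - intros t eps Ht He.
    destruct (half_pow_small (eps / (d + 4 * (C * d) + 1))) as [k Hk]; [apply Rdiv_lt_0_compat; nra|].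
    apply Rmult_lt_compat_r with (r := d + 4 * (C * d) + 1) in Hk; [|nra].
    replace (eps / (d + 4 * (C * d) + 1) * (d + 4 * (C * d) + 1)) with eps in Hk by (field; nra).
    assert (HMk : 0 < INR (M ^ k)) by (apply lt_0_INR; pose proof (Nat.pow_nonzero M k); lia).
    exists (/ INR (M ^ k)). split; [now apply Rinv_0_lt_compat|]. intros s Hs Hst.
    assert (Hadj : mdist (P k (fl k s)) (P k (fl k t)) <= d * (/ 2) ^ k).
    { assert (Hdiff : Rabs (INR (M ^ k) * s - INR (M ^ k) * t) < 1).
      { rewrite <- Rmult_minus_distr_l, Rabs_mult, (Rabs_pos_eq (INR (M ^ k))) by lra.
        apply Rmult_lt_compat_l with (r := INR (M ^ k)) in Hst; [|assumption].
        rewrite Rinv_r in Hst; lra. }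
      pose proof (Hfl k s ltac:(lra)). pose proof (Hfl k t ltac:(lra)).
      assert (H1 : (fl k s < fl k t + 2)%nat).
      { apply INR_lt. rewrite plus_INR. simpl. rabs. }
      assert (H2 : (fl k t < fl k s + 2)%nat).
      { apply INR_lt. rewrite plus_INR. simpl. rabs. }
      destruct (lt_eq_lt_dec (fl k s) (fl k t)) as [[Hlt|E]|Hlt].
      - replace (fl k t) with (S (fl k s)) by lia. apply Hstep.
      - rewrite E, mdist_refl. specialize (Hhalf k). nra.
      - replace (fl k s) with (S (fl k t)) by lia. rewrite mdist_sym. apply Hstep. }
    pose proof (Hg s ltac:(lra) k) as Gs. pose proof (Hg t ltac:(lra) k) as Gt.
    rewrite (mdist_sym X _ (g s)) in Gs.
    pose proof (mdist_tri X (g s) (P k (fl k s)) (g t)).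
    pose proof (mdist_tri X (P k (fl k s)) (P k (fl k t)) (g t)).
    specialize (Hhalf k). lra.
  - apply Huniq; [lra|]. intros k. replace (fl k 0) with O; [apply Hend|].
    apply INR_floor_unique with (INR (M ^ k) * 0); [simpl; lra|apply Hfl; lra].
  - apply Huniq; [lra|]. intros k. replace (fl k 1) with (M ^ k)%nat; [apply Hend|].
    apply INR_floor_unique with (INR (M ^ k) * 1); [lra|apply Hfl; lra].
  - intros t Ht. fold d. specialize (Hg t ltac:(lra) O).
    (* At [t = 1] the level-0 index is 1 instead of 0, so the limit estimate does not start from
       [a]. *)
    destruct (Req_dec t 1) as [->|Hne].
    + replace (g 1) with b; [fold d; nra|]. symmetry. apply Huniq; [lra|]. intros k.
      replace (fl k 1) with (M ^ k)%nat; [apply Hend|].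
      apply INR_floor_unique with (INR (M ^ k) * 1); [lra|apply Hfl; lra].
    + replace (fl O t) with O in Hg; [simpl in Hg; lra|].
      apply INR_floor_unique with (INR (M ^ 0) * t); [simpl; lra|apply Hfl; lra].
Qed.

Lemma arc_diameter (T : MetricSpace) (N : nat) (C : R) :
  metric_tree T -> (1 <= N)%nat -> doubling_with T N -> 1 <= C -> turning_with T C ->
  forall (x y : T) A z, x <> y -> is_arc T A x y -> A z -> mdist x z <= 2 * C * mdist x y.
Proof.
  intros (Hc & _ & _ & _ & Hu) HN1 HN HC HT x y A z Hxy HA Hz.
  destruct (turning_path T N C (compact_complete T Hc) HN1 HN HC HT x y) as (g & Hg & <- & <- & Hb).
  destruct (path_contains_arc T g Hg Hxy) as (B & HB & HBg).
  destruct (Hu _ _ Hxy) as [_ Huniq]. apply (Huniq A B HA HB), HBg in Hz.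
  destruct Hz as (t & Ht & <-). now apply Hb.
Qed.

(** * Recognising quasiconformal trees *)

Definition joined (X : MetricSpace) (P : X -> Prop) (x y : X) : Prop :=
  exists g, path_continuous X g /\ g 0 = x /\ g 1 = y /\ forall t, 0 <= t <= 1 -> P (g t).

Lemma joined_sym (X : MetricSpace) (P : X -> Prop) (x y : X) : joined X P x y -> joined X P y x.
Proof.
  intros (g & Hg & <- & <- & HP). exists (fun t => g (1 - t)).
  split; [|split; [f_equal; lra|split; [f_equal; lra|intros t Ht; apply HP; lra]]].
  intros t eps Ht He. destruct (Hg (1 - t) eps) as (d & Hd & H); [lra|assumption|].
  exists d. split; [assumption|]. intros s Hs Hst. apply H; [lra|rabs].
Qed.

Lemma joined_trans (X : MetricSpace) (P : X -> Prop) (x y z : X) :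
  joined X P x y -> joined X P y z -> joined X P x z.
Proof.
  intros (g & Hg & <- & <- & HP) (h & Hh & E & <- & HQ).
  exists (fun t => if Rle_dec t (1 / 2) then g (2 * t) else h (2 * t - 1)).
  split; [|split; [|split]].
  - intros t eps Ht He. destruct (Rtotal_order t (1 / 2)) as [Hlt|[Heq|Hgt]].
    + destruct (Hg (2 * t) eps) as (d & Hd & H); [lra|assumption|].
      exists (Rmin (d / 2) (1 / 2 - t)). pose proof (Rmin_l (d / 2) (1 / 2 - t)).
      pose proof (Rmin_r (d / 2) (1 / 2 - t)). split; [apply Rmin_glb_lt; lra|].
      intros s Hs Hst. destruct (Rle_dec s (1 / 2)); [|exfalso; rabs].
      destruct (Rle_dec t (1 / 2)); [|lra]. apply H; [lra|rabs].
    + destruct (Hg 1 eps) as (d & Hd & H); [lra|assumption|].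
      destruct (Hh 0 eps) as (d' & Hd' & H'); [lra|assumption|].
      exists (Rmin d d' / 2). pose proof (Rmin_l d d'). pose proof (Rmin_r d d').
      pose proof (Rmin_glb_lt d d' 0 Hd Hd'). split; [lra|]. intros s Hs Hst.
      destruct (Rle_dec t (1 / 2)); [|lra]. replace (2 * t) with 1 by lra.
      destruct (Rle_dec s (1 / 2)); [apply H; [lra|rabs]|]. rewrite <- E. apply H'; [lra|rabs].
    + destruct (Hh (2 * t - 1) eps) as (d & Hd & H); [lra|assumption|].
      exists (Rmin (d / 2) (t - 1 / 2)). pose proof (Rmin_l (d / 2) (t - 1 / 2)).
      pose proof (Rmin_r (d / 2) (t - 1 / 2)). split; [apply Rmin_glb_lt; lra|].
      intros s Hs Hst. destruct (Rle_dec s (1 / 2)); [exfalso; rabs|].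
      destruct (Rle_dec t (1 / 2)); [lra|]. apply H; [lra|rabs].
  - destruct Rle_dec; [f_equal; lra|lra].
  - destruct Rle_dec; [lra|f_equal; lra].
  - intros t Ht. destruct Rle_dec; [apply HP; lra|apply HQ; lra].
Qed.

Lemma joined_mono (X : MetricSpace) (P Q : X -> Prop) (x y : X) :
  (forall z, P z -> Q z) -> joined X P x y -> joined X Q x y.
Proof. intros H (g & ? & ? & ? & ?). exists g. auto 6. Qed.

Lemma joined_connected (X : MetricSpace) (A : X -> Prop) (x : X) :
  (forall y, A y -> joined X A x y) -> connected_set X A.
Proof.
  intros HA (U & V & HU & HV & Hc & (y & Hy & Hy') & (z & Hz & Hz') & Hd).
  assert (Hj : joined X A y z) by (apply joined_trans with x; [apply joined_sym|]; auto).
  destruct Hj as (g & Hg & <- & <- & HP).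
  apply (trace_connected X g Hg). exists U, V. repeat split; auto.
  - intros w (t & Ht & <-). auto.
  - exists (g 0). split; [exists 0; split; [lra|reflexivity]|assumption].
  - exists (g 1). split; [exists 1; split; [lra|reflexivity]|assumption].
  - intros w (t & Ht & <-). apply Hd; auto.
Qed.

(** A set without finite subcover contains another one inside a ball of radius [2^-k]. Points picked
    from the resulting nested sets converge, and the member of the cover around the limit swallows
    one of these sets. *)
Lemma complete_totally_bounded_compact (X : MetricSpace) :
  complete X ->
  (forall k, exists cs : list X, forall y, exists c, In c cs /\ ball X c ((/ 2) ^ k) y) ->
  compact_set X (fun _ => True).
Proof.
  intros HX Htb I U HU Hcov. apply NNPP. intros HN.
  set (big := fun A : X -> Prop => ~ exists l : list I, forall x, A x -> exists i, In i l /\ U i x).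
  assert (Hsplit : forall (cs : list X) (A : X -> Prop) r, big A ->
    (forall y, A y -> exists c, In c cs /\ ball X c r y) ->
    exists c, big (fun y => A y /\ ball X c r y)).
  { intros cs A r HA Hcs. apply NNPP. intros Hn. apply HA.
    assert (H : exists l : list I, forall x c, A x -> In c cs -> ball X c r x -> exists i, In i l /\ U i x).
    { clear Hcs. induction cs as [|c cs (l & Hl)]; [exists nil; intros x c _ []|].
      assert (Hc : exists l : list I, forall x, A x /\ ball X c r x -> exists i, In i l /\ U i x)
        by (apply NNPP; intros Hc; apply Hn; now exists c).
      destruct Hc as (l' & Hl'). exists (l ++ l'). intros x c' Ax [<-|Hin] Hb.
      - destruct (Hl' x (conj Ax Hb)) as (i & ? & ?). exists i. split; [apply in_or_app|]; auto.
      - destruct (Hl x c' Ax Hin Hb) as (i & ? & ?). exists i. split; [apply in_or_app|]; auto. }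
    destruct H as (l & Hl). exists l. intros x Ax. destruct (Hcs x Ax) as (c & ? & ?). eauto. }
  destruct (dependent_choice (X -> Prop) big
    (fun k A B => (forall x, B x -> A x) /\ exists c, forall x, B x -> ball X c ((/ 2) ^ k) x)
    (fun _ => True)) as (A & _ & HA).
  - assumption.
  - intros k A HA. destruct (Htb k) as [cs Hcs].
    destruct (Hsplit cs A ((/ 2) ^ k) HA) as [c Hc]; [auto|].
    exists (fun y => A y /\ ball X c ((/ 2) ^ k) y). split; [assumption|].
    split; [tauto|]. exists c. tauto.
  - assert (Hne : forall k, exists x, A k x).
    { intros k. apply NNPP. intros Hn. apply (proj1 (HA k)). exists nil.
      intros x Hx. destruct Hn. now exists x. }
    assert (Hdiam : forall k x y, A (S k) x -> A (S k) y -> mdist x y <= 2 * (/ 2) ^ k).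
    { intros k x y Hx Hy. destruct (HA k) as (_ & _ & c & Hc). apply Hc in Hx, Hy.
      unfold ball in *. pose proof (mdist_tri X x c y). rewrite (mdist_sym X x c) in *. lra. }
    assert (Hex : exists u : nat -> X, forall k, A (S k) (u k))
      by (apply (choice (fun k x => A (S k) x)); intros k; apply Hne).
    destruct Hex as [u Hu].
    destruct (geometric_limit X u 2 HX) as [l Hl].
    { intros k. apply Hdiam; [apply Hu|]. apply HA, Hu. }
    destruct (Hcov l) as [i Hi]; [exact Logic.I|].
    (* For [x] in [A (S k)], [l] is within [4 2^-k] of [u k], and [u k] within [2 2^-k] of [x];
       hence [r/6]. *)
    destruct (HU i l Hi) as (r & Hr & Hb). destruct (half_pow_small (r / 6)) as [k Hk]; [lra|].
    apply (proj1 (HA (S k))). exists (i :: nil). intros x Hx. exists i. split; [now left|].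
    apply Hb. unfold ball. pose proof (mdist_tri X l (u k) x). rewrite (mdist_sym X l (u k)) in *.
    pose proof (Hdiam k (u k) x (Hu k) Hx). specialize (Hl k). lra.
Qed.

(** Every path from [x] to [y] must then pass through [z]; uniqueness of arcs in the comb rests on
    this. *)
Definition separates (X : MetricSpace) (z x y : X) : Prop :=
  z <> x /\ z <> y /\ exists U V : X -> Prop, is_open X U /\ is_open X V /\ U x /\ V y /\
    (forall w, w <> z -> U w \/ V w) /\ (forall w, U w -> V w -> False).

Lemma separates_path (X : MetricSpace) (z : X) (g : R -> X) :
  path_continuous X g -> separates X z (g 0) (g 1) -> trace X g z.
Proof.
  intros Hg (_ & _ & U & V & HU & HV & Hx & Hy & Hc & Hd). apply NNPP. intros HN.
  apply (trace_connected X g Hg). exists U, V. repeat split; auto.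
  - intros w Hw. apply Hc. intros ->. contradiction.
  - exists (g 0). split; [exists 0; split; [lra|reflexivity]|assumption].
  - exists (g 1). split; [exists 1; split; [lra|reflexivity]|assumption].
  - intros w _. apply Hd.
Qed.

Lemma subpath_continuous (X : MetricSpace) (g : R -> X) (a b : R) :
  path_continuous X g -> 0 <= a <= 1 -> 0 <= b <= 1 ->
  path_continuous X (fun t => g (a + t * (b - a))).
Proof.
  intros Hg Ha Hb t eps Ht He.
  assert (Hin : forall s, 0 <= s <= 1 -> 0 <= a + s * (b - a) <= 1) by (intros s Hs; nra).
  destruct (Hg (a + t * (b - a)) eps) as (d & Hd & H); [auto|assumption|].
  exists d. split; [assumption|]. intros s Hs Hst. apply H; [auto|].
  replace (a + s * (b - a) - (a + t * (b - a))) with ((s - t) * (b - a)) by ring.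
  rewrite Rabs_mult. assert (Rabs (b - a) <= 1) by rabs.
  pose proof (Rabs_pos (s - t)). nra.
Qed.

Lemma arc_path (X : MetricSpace) (A : X -> Prop) (x y : X) :
  is_arc X A x y -> exists g, path_continuous X g /\ g 0 = x /\ g 1 = y /\
    (forall z, A z <-> trace X g z) /\
    forall s t, 0 <= s <= 1 -> 0 <= t <= 1 -> g s = g t -> s = t.
Proof. intros (g & H0 & H1 & Htr & Hinj & Hc & _). exists g. auto. Qed.

(* If [w] lay on [B] but not on [A], the piece of [B] between its last visit to [A] before [w] and
   the first one after [w] would close up with [A] to a loop; no point separates two points of a loop. *)
Lemma arc_unique_of_separation (X : MetricSpace) :
  (forall x y : X, x <> y -> exists z, separates X z x y) ->
  forall (x y : X) A B, is_arc X A x y -> is_arc X B x y -> forall w, B w -> A w.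
Proof.
  intros Hsep x y A B HA HB w Hw.
  destruct (arc_path X A x y HA) as (g & Hg & <- & <- & HAg & Hinjg).
  destruct (arc_path X B _ _ HB) as (h & Hh & E0 & E1 & HBh & Hinjh).
  apply HBh in Hw. destruct Hw as (t & Ht & <-). apply NNPP. intros HN.
  assert (Hcl : closed_in_R (fun s => 0 <= s <= 1 /\ A (h s))).
  { intros s Hs. destruct (skeleton_interval X h) as (Hcl & _).
    destruct (classic (0 <= s <= 1)) as [Hs01|Hs01].
    - assert (HsA : ~ A (h s)) by tauto.
      (* [A] is the image of a compact interval, so [h s] has positive distance from it. *)
      assert (Hdist : exists e, 0 < e /\ forall u, 0 <= u <= 1 -> e <= mdist (g u) (h s)).
      { destruct (interval_local_global 0 1 (fun Q => exists e, 0 < e /\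
          forall u, Q u -> e <= mdist (g u) (h s))) as (e & He & H); [lra| | | |now exists e].
        - intros Q Q' HQ (e & He & H). exists e. auto.
        - intros Q Q' (e & He & H) (e' & He' & H'). exists (Rmin e e').
          pose proof (Rmin_l e e'). pose proof (Rmin_r e e').
          split; [now apply Rmin_glb_lt|]. intros u [Hu|Hu]; [specialize (H u Hu)|specialize (H' u Hu)]; lra.
        - intros v Hv. assert (Hpos : 0 < mdist (g v) (h s)).
          { apply mdist_gt0. intros E. apply HsA, HAg. rewrite <- E. now exists v. }
          destruct (Hg v (mdist (g v) (h s) / 2) Hv) as (d & Hd & H); [lra|].
          exists d. split; [assumption|]. exists (mdist (g v) (h s) / 2). split; [lra|].
          intros u [Hu Huv]. specialize (H u Hu Huv).
          pose proof (mdist_tri X (g v) (g u) (h s)). rewrite (mdist_sym X (g v) (g u)) in *. lra. }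
      destruct Hdist as (e & He & Hdist). destruct (Hh s e Hs01 He) as (d & Hd & H).
      exists d. split; [assumption|]. intros u Hu [Hu01 Hu'].
      apply HAg in Hu'. destruct Hu' as (v & Hv & Ev). specialize (Hdist v Hv). rewrite Ev in Hdist.
      specialize (H u Hu01 Hu). lra.
    - destruct (Hcl s Hs01) as (r & Hr & H). exists r. split; [assumption|].
      intros u Hu [Hu' _]. now apply (H u Hu). }
  assert (A0 : A (h 0)) by (rewrite E0; apply HAg; exists 0; split; [lra|reflexivity]).
  assert (A1 : A (h 1)) by (rewrite E1; apply HAg; exists 1; split; [lra|reflexivity]).
  destruct (closed_pred _ 0 t Hcl) as (a & [_ Aa] & Ha & Ma); [split; [lra|assumption]|lra|].
  destruct (closed_succ _ 1 t Hcl) as (b & [_ Ab] & Hb & Mb); [split; [lra|assumption]|lra|].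
  assert (Hat : a <> t) by (intros ->; contradiction).
  assert (Hbt : b <> t) by (intros ->; contradiction).
  destruct (Hsep (h a) (h b)) as (z & Hz).
  { intros E. apply Hinjh in E; lra. }
  (* [z] lies on the piece of [A] between [h a] and [h b], and likewise on that of [B]. Its
     parameter on [B] is strictly between [a] and [b], against the choice of one of them. *)
  assert (Az : A z).
  { apply HAg in Aa, Ab. destruct Aa as (u & Hu & Eu), Ab as (v & Hv & Ev).
    destruct (separates_path X z (fun s => g (u + s * (v - u)))) as (s & Hs & <-).
    - now apply subpath_continuous.
    - replace (u + 0 * (v - u)) with u by ring. replace (u + 1 * (v - u)) with v by ring.
      now rewrite Eu, Ev.
    - apply HAg. exists (u + s * (v - u)). split; [nra|reflexivity]. }
  destruct (separates_path X z (fun s => h (a + s * (b - a)))) as (s & Hs & Es).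
  - apply subpath_continuous; [assumption|lra|lra].
  - replace (a + 0 * (b - a)) with a by ring. replace (a + 1 * (b - a)) with b by ring. assumption.
  - destruct Hz as (Hza & Hzb & _). rewrite <- Es in *.
    set (c := a + s * (b - a)) in *. assert (Hc : a <= c <= b) by (unfold c; nra).
    destruct (Req_dec c a) as [E|]; [rewrite E in Hza; now destruct Hza|].
    destruct (Req_dec c b) as [E|]; [rewrite E in Hzb; now destruct Hzb|].
    destruct (Rle_lt_dec c t) as [Hle|Hlt].
    + assert (c <= a); [|lra]. apply Ma; [|assumption]. split; [lra|assumption].
    + assert (b <= c); [|lra]. apply Mb; [|lra]. split; [lra|assumption].
Qed.

(** * Combs *)

Lemma length_flat_map_const (A B : Type) (f : A -> list B) (c : nat) (l : list A) :
  (forall x, length (f x) = c) -> length (flat_map f l) = (length l * c)%nat.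
Proof.
  intros H. induction l as [|x l IH]; [reflexivity|]. simpl. now rewrite length_app, H, IH.
Qed.

(** Any point of a nonempty cell is the centre of a ball of radius [r/2] covering it, so cells of
    convenient shape can replace balls in the doubling condition. *)
Lemma cover_by_small_cells (X : MetricSpace) (x : X) (r : R) (cells : list (X -> Prop)) :
  (forall Q, In Q cells -> forall y z, Q y -> Q z -> mdist y z < r / 2) ->
  (forall y, ball X x r y -> exists Q, In Q cells /\ Q y) ->
  exists cs, (length cs <= length cells)%nat /\
    forall y, ball X x r y -> exists c, In c cs /\ ball X c (r / 2) y.
Proof.
  intros Hsmall Hcov.
  assert (H : exists cs, (length cs <= length cells)%nat /\
    forall Q y, In Q cells -> Q y -> exists c, In c cs /\ ball X c (r / 2) y).
  { clear Hcov. induction cells as [|Q cells IH]; [exists nil; split; [auto|intros Q y []]|].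
    destruct IH as (cs & Hl & Hcs); [intros; apply (Hsmall Q0); auto; now right|].
    destruct (classic (exists c, Q c)) as [[c Hc]|HN].
    - exists (c :: cs). split; [simpl; lia|]. intros Q' y [<-|HQ'] Hy.
      + exists c. split; [now left|]. apply (Hsmall Q); auto. now left.
      + destruct (Hcs Q' y HQ' Hy) as (c' & ? & ?). exists c'. split; [now right|assumption].
    - exists cs. split; [simpl; lia|]. intros Q' y [<-|HQ'] Hy; [|now apply (Hcs Q')].
      destruct HN. now exists y. }
  destruct H as (cs & Hl & Hcs). exists cs. split; [assumption|].
  intros y Hy. destruct (Hcov y Hy) as (Q & HQ & HQy). eauto.
Qed.

Lemma grid_cell (lo w x : R) (m : nat) :
  0 < w -> lo <= x < lo + INR m * w ->
  exists i, (i < m)%nat /\ lo + INR i * w <= x < lo + INR i * w + w.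
Proof.
  intros Hw Hx. destruct (nat_floor ((x - lo) / w)) as [i Hi].
  { apply Rle_mult_inv_pos; lra. }
  assert (E : (x - lo) / w * w = x - lo) by (field; lra).
  exists i. split; [apply INR_lt|]; nra.
Qed.

Lemma limit_le (u : nat -> R) (l c : R) : Un_cv u l -> (forall n, u n <= c) -> l <= c.
Proof.
  intros Hu Hc. apply Rnot_lt_le. intros Hlt. destruct (Hu (l - c)) as [N HN]; [lra|].
  specialize (HN N (le_n N)). specialize (Hc N). unfold Rdist in HN. rabs.
Qed.

(* The spine [0,2] x {0} with a vertical tooth of height [a] over each [a] in [P]. The distance
   is the length of the shortest curve inside the comb. *)
Definition on_comb (P : R -> Prop) (q : R * R) : Prop :=
  0 <= fst q <= 2 /\ 0 <= snd q <= fst q /\ (snd q = 0 \/ P (fst q)).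

Definition comb_dist (q r : R * R) : R :=
  if Req_EM_T (fst q) (fst r) then Rabs (snd q - snd r)
  else snd q + snd r + Rabs (fst q - fst r).

Definition comb (P : R -> Prop) : MetricSpace.
Proof.
  refine (@Build_MetricSpace {q | on_comb P q} (fun x y => comb_dist (proj1_sig x) (proj1_sig y)) _ _ _ _).
  - intros [[a s] H]. unfold comb_dist. simpl. destruct Req_EM_T; [rabs|congruence].
  - intros [[a s] Hx] [[b t] Hy]. unfold comb_dist. simpl. intros E.
    assert ((a, s) = (b, t)) as E'.
    { unfold on_comb in *. simpl in *. destruct Req_EM_T; f_equal; rabs. }
    apply eq_sig_hprop; [intros; apply proof_irrelevance|exact E'].
  - intros [[a s] Hx] [[b t] Hy]. unfold comb_dist. simpl.
    destruct Req_EM_T; destruct Req_EM_T; try congruence; rabs.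
  - intros [[a s] Hx] [[b t] Hy] [[c u] Hz]. unfold comb_dist, on_comb in *. simpl in *.
    destruct (Req_EM_T a c); destruct (Req_EM_T a b); destruct (Req_EM_T b c); subst;
      try congruence; rabs.
Defined.

Section Comb.
Variable P : R -> Prop.

Definition col (x : comb P) : R := fst (proj1_sig x).
Definition height (x : comb P) : R := snd (proj1_sig x).

Lemma comb_range (x : comb P) : 0 <= col x <= 2 /\ 0 <= height x <= col x.
Proof. unfold col, height. destruct (proj2_sig x) as (H1 & H2 & _). lra. Qed.

Lemma comb_tooth (x : comb P) : height x = 0 \/ P (col x).
Proof. exact (proj2 (proj2 (proj2_sig x))). Qed.

Lemma comb_ext (x y : comb P) : col x = col y -> height x = height y -> x = y.
Proof.
  intros H1 H2. apply eq_sig_hprop; [intros; apply proof_irrelevance|].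
  now apply injective_projections.
Qed.

Lemma comb_dist_cases (x y : comb P) :
  (col x = col y /\ mdist x y = Rabs (height x - height y)) \/
  (col x <> col y /\ mdist x y = height x + height y + Rabs (col x - col y)).
Proof.
  unfold col, height. simpl. unfold comb_dist. destruct Req_EM_T; auto.
Qed.

Lemma comb_dist_ge_col (x y : comb P) : Rabs (col x - col y) <= mdist x y.
Proof.
  pose proof (comb_range x). pose proof (comb_range y).
  destruct (comb_dist_cases x y) as [[E ->]|[E ->]]; rabs.
Qed.

Lemma comb_dist_ge_height (x y : comb P) : Rabs (height x - height y) <= mdist x y.
Proof.
  pose proof (comb_range x). pose proof (comb_range y).
  destruct (comb_dist_cases x y) as [[E ->]|[E ->]]; rabs.
Qed.

Lemma on_comb_origin : on_comb P (0, 0).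
Proof. unfold on_comb. simpl. lra. Qed.

(* Junk value: the origin when [(a, s)] is not on the comb. *)
Definition comb_point (a s : R) : comb P :=
  match excluded_middle_informative (on_comb P (a, s)) with
  | left H => exist _ (a, s) H
  | right _ => exist _ (0, 0) on_comb_origin
  end.

Lemma comb_point_coords (a s : R) :
  0 <= a <= 2 -> 0 <= s <= a -> s = 0 \/ P a ->
  col (comb_point a s) = a /\ height (comb_point a s) = s.
Proof.
  intros H1 H2 H3. unfold comb_point. destruct excluded_middle_informative as [H|H]; [split; reflexivity|].
  destruct H. unfold on_comb. auto.
Qed.

Lemma comb_point_eta (x : comb P) : comb_point (col x) (height x) = x.
Proof.
  pose proof (comb_range x). destruct (comb_point_coords (col x) (height x)); try lra.
  - apply comb_tooth.
  - now apply comb_ext.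
Qed.

Lemma lipschitz_path (g : R -> comb P) (L : R) :
  (forall s t, 0 <= s <= 1 -> 0 <= t <= 1 -> mdist (g s) (g t) <= L * Rabs (s - t)) ->
  path_continuous (comb P) g.
Proof.
  intros H t eps Ht He. exists (eps / (Rabs L + 1)). pose proof (Rabs_pos L).
  split; [apply Rdiv_lt_0_compat; lra|]. intros s Hs Hst.
  apply Rle_lt_trans with (1 := H s t Hs Ht).
  apply Rmult_lt_compat_r with (r := Rabs L + 1) in Hst; [|lra].
  replace (eps / (Rabs L + 1) * (Rabs L + 1)) with eps in Hst by (field; lra).
  pose proof (Rabs_pos (s - t)). pose proof (Rle_abs L). nra.
Qed.

Lemma vertical_coords (x y : comb P) (u : R) : col x = col y -> 0 <= u <= 1 ->
  col (comb_point (col x) (height x + u * (height y - height x))) = col x /\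
  height (comb_point (col x) (height x + u * (height y - height x)))
    = height x + u * (height y - height x).
Proof.
  intros E Hu. pose proof (comb_range x). pose proof (comb_range y). apply comb_point_coords.
  - lra.
  - rewrite <- E in *. nra.
  - destruct (comb_tooth x); [|now right]. destruct (comb_tooth y); [|right; congruence].
    left. nra.
Qed.

Lemma vertical_path (x y : comb P) : col x = col y ->
  path_continuous (comb P) (fun u => comb_point (col x) (height x + u * (height y - height x))).
Proof.
  intros E. apply lipschitz_path with (Rabs (height y - height x)). intros s t Hs Ht.
  destruct (vertical_coords x y s E Hs) as [C1 H1].
  destruct (vertical_coords x y t E Ht) as [C2 H2].
  destruct (comb_dist_cases (comb_point (col x) (height x + s * (height y - height x)))
    (comb_point (col x) (height x + t * (height y - height x)))) as [[_ ->]|[N _]];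
    [|congruence].
  rewrite H1, H2, <- Rabs_mult. right. f_equal. ring.
Qed.

Lemma vertical_joined (x y : comb P) : col x = col y ->
  joined (comb P) (fun w => col w = col x /\
    (height x <= height w <= height y \/ height y <= height w <= height x)) x y.
Proof.
  intros E. eexists. split; [now apply (vertical_path x y)|]. cbv beta. split; [|split].
  - rewrite Rmult_0_l, Rplus_0_r. apply comb_point_eta.
  - replace (height x + 1 * (height y - height x)) with (height y) by ring. rewrite E.
    apply comb_point_eta.
  - intros u Hu. destruct (vertical_coords x y u E Hu) as [-> ->]. split; [reflexivity|].
    destruct (Rle_lt_dec (height x) (height y)); [left|right]; nra.
Qed.

Lemma spine_joined (a b : R) : 0 <= a <= 2 -> 0 <= b <= 2 ->
  joined (comb P) (fun w => height w = 0 /\ (a <= col w <= b \/ b <= col w <= a))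
    (comb_point a 0) (comb_point b 0).
Proof.
  intros Ha Hb.
  assert (Hc : forall u, 0 <= u <= 1 -> col (comb_point (a + u * (b - a)) 0) = a + u * (b - a) /\
      height (comb_point (a + u * (b - a)) 0) = 0).
  { intros u Hu. apply comb_point_coords; [nra|nra|now left]. }
  exists (fun u => comb_point (a + u * (b - a)) 0). split; [|split; [|split]].
  - apply lipschitz_path with (Rabs (b - a)). intros s t Hs Ht.
    destruct (Hc s Hs) as [C1 H1]. destruct (Hc t Ht) as [C2 H2].
    replace (Rabs (b - a) * Rabs (s - t)) with (Rabs ((a + s * (b - a)) - (a + t * (b - a)))).
    2:{ rewrite <- Rabs_mult. f_equal. ring. }
    destruct (comb_dist_cases (comb_point (a + s * (b - a)) 0) (comb_point (a + t * (b - a)) 0))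
      as [[_ ->]|[_ ->]]; rewrite H1, H2; [|rewrite C1, C2; lra].
    rewrite Rminus_diag, Rabs_R0. apply Rabs_pos.
  - f_equal; ring.
  - f_equal; ring.
  - intros u Hu. destruct (Hc u Hu) as [-> ->]. split; [reflexivity|].
    destruct (Rle_lt_dec a b); [left|right]; nra.
Qed.

Lemma through_spine_joined (x y : comb P) :
  joined (comb P) (fun w => (col w = col x /\ height w <= height x) \/
    (col w = col y /\ height w <= height y) \/
    (height w = 0 /\ (col x <= col w <= col y \/ col y <= col w <= col x))) x y.
Proof.
  assert (Hdown : forall z : comb P, joined (comb P)
    (fun w => col w = col z /\ height w <= height z) z (comb_point (col z) 0)).
  { intros z. pose proof (comb_range z).
    destruct (comb_point_coords (col z) 0) as [E1 E2]; [lra|lra|now left|].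
    apply joined_mono with (2 := vertical_joined z (comb_point (col z) 0) (eq_sym E1)).
    intros w. pose proof (comb_range w). intros [? ?]. split; [assumption|]. lra. }
  apply joined_trans with (comb_point (col x) 0); [|apply joined_trans with (comb_point (col y) 0)].
  - apply joined_mono with (2 := Hdown x). tauto.
  - pose proof (comb_range x). pose proof (comb_range y).
    apply joined_mono with (2 := spine_joined (col x) (col y) ltac:(lra) ltac:(lra)). tauto.
  - apply joined_sym. apply joined_mono with (2 := Hdown y). tauto.
Qed.

(** Along a common tooth, or down a tooth, along the spine and up again, the distance from [x] never
    exceeds its final value. Balls thus become path-connected, and bounded turning follows. *)
Lemma joined_within_distance (x y : comb P) :
  joined (comb P) (fun w => mdist x w <= mdist x y) x y.
Proof.
  pose proof (comb_range x). pose proof (comb_range y).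
  destruct (comb_dist_cases x y) as [[E ->]|[E ->]].
  - apply joined_mono with (2 := vertical_joined x y E). intros w [Ew Hw].
    destruct (comb_dist_cases x w) as [[_ ->]|[N _]]; [rabs|congruence].
  - apply joined_mono with (2 := through_spine_joined x y). intros w Hw.
    pose proof (comb_range w).
    destruct (comb_dist_cases x w) as [[Ew ->]|[Ew ->]];
      destruct Hw as [[? ?]|[[? ?]|[? ?]]]; rabs.
Qed.

Lemma above_open (c m : R) : 0 <= m -> is_open (comb P) (fun w => col w = c /\ m < height w).
Proof.
  intros Hm w [E Hw]. exists (height w - m). split; [lra|]. intros v Hv. unfold ball in Hv.
  pose proof (comb_range v).
  destruct (comb_dist_cases w v) as [[E' D]|[E' D]]; rewrite D in Hv.
  - split; [congruence|rabs].
  - exfalso. rabs.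
Qed.

Lemma not_above_open (c m : R) : is_open (comb P) (fun w => ~ (col w = c /\ m <= height w)).
Proof.
  intros w Hw. destruct (Req_dec (col w) c) as [E|E].
  - exists (m - height w). split; [apply Rnot_le_lt; intros H; apply Hw; split; [assumption|lra]|].
    intros v Hv [Ev Hm]. unfold ball in Hv. pose proof (comb_dist_ge_height w v). rabs.
  - exists (Rabs (col w - c)). split; [apply Rabs_pos_lt; lra|].
    intros v Hv [Ev Hm]. unfold ball in Hv. pose proof (comb_dist_ge_col w v). rewrite Ev in *. lra.
Qed.

Lemma left_open (c : R) : is_open (comb P) (fun w => col w < c).
Proof.
  intros w Hw. exists (c - col w). split; [lra|]. intros v Hv. unfold ball in Hv.
  pose proof (comb_dist_ge_col w v). rabs.
Qed.

(** The tooth over [c], without its foot, is counted with the right-hand side, so that this set and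
    the one of [left_open] exhaust the complement of the spine point at [c]. *)
Lemma right_open (c : R) :
  is_open (comb P) (fun w => c < col w \/ (col w = c /\ 0 < height w)).
Proof.
  intros w [Hw|Hw].
  - exists (col w - c). split; [lra|]. intros v Hv. unfold ball in Hv. left.
    pose proof (comb_dist_ge_col w v). rabs.
  - destruct (above_open c 0 (Rle_refl 0) w Hw) as (r & Hr & H). exists r. auto.
Qed.

Lemma separates_above (z x y : comb P) :
  col x = col z -> height z < height x -> ~ (col y = col z /\ height z <= height y) ->
  separates (comb P) z x y.
Proof.
  intros Hc Hh Hy. pose proof (comb_range z). split; [intros ->; lra|].
  split; [intros ->; apply Hy; split; [reflexivity|lra]|].
  exists (fun w => col w = col z /\ height z < height w),
    (fun w => ~ (col w = col z /\ height z <= height w)).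
  split; [now apply above_open|]. split; [apply not_above_open|].
  split; [auto|]. split; [auto|]. split; [|intros w [? ?] H'; apply H'; split; [assumption|lra]].
  intros w Hw. destruct (classic (col w = col z /\ height z <= height w)) as [[E1 E2]|]; [left|now right].
  split; [assumption|]. destruct E2 as [|E2]; [assumption|]. destruct Hw. now apply comb_ext.
Qed.

Lemma separates_spine (z x y : comb P) :
  height z = 0 -> col x < col z < col y -> separates (comb P) z x y.
Proof.
  intros Hz Hc. split; [intros ->; lra|]. split; [intros ->; lra|].
  exists (fun w => col w < col z), (fun w => col z < col w \/ (col w = col z /\ 0 < height w)).
  split; [apply left_open|]. split; [apply right_open|].
  split; [lra|]. split; [lra|]. split; [|intros; lra].
  intros w Hw. destruct (Rtotal_order (col w) (col z)) as [|[E|]]; [now left| |right; now left].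
  right; right. split; [assumption|]. pose proof (comb_range w).
  destruct (Req_dec (height w) 0); [|lra]. destruct Hw. apply comb_ext; lra.
Qed.

Lemma separates_sym (X : MetricSpace) (z x y : X) : separates X z x y -> separates X z y x.
Proof.
  intros (H1 & H2 & U & V & HU & HV & Hx & Hy & Hc & Hd).
  split; [assumption|]. split; [assumption|]. exists V, U. repeat split; auto.
  - intros w Hw. destruct (Hc w Hw); auto.
  - intros w Hv Hu. now apply (Hd w).
Qed.

Lemma comb_separation (x y : comb P) : x <> y -> exists z, separates (comb P) z x y.
Proof.
  intros Hxy. pose proof (comb_range x) as Rx. pose proof (comb_range y) as Ry.
  assert (Hv : forall p q : comb P, col p = col q -> height p < height q ->
      exists z, separates (comb P) z q p).
  { intros p q E H. pose proof (comb_range p). pose proof (comb_range q).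
    destruct (comb_point_coords (col q) ((height p + height q) / 2)) as [E1 E2]; [lra|lra| |].
    { right. destruct (comb_tooth q); [lra|assumption]. }
    exists (comb_point (col q) ((height p + height q) / 2)).
    apply separates_above; rewrite ?E1, ?E2; lra. }
  assert (Hs : forall p q : comb P, col p < col q -> exists z, separates (comb P) z p q).
  { intros p q H. pose proof (comb_range p). pose proof (comb_range q).
    destruct (comb_point_coords ((col p + col q) / 2) 0) as [E1 E2]; [lra|lra|now left|].
    exists (comb_point ((col p + col q) / 2) 0). apply separates_spine; rewrite ?E1, ?E2; lra. }
  destruct (Rtotal_order (col x) (col y)) as [H|[E|H]].
  - now apply Hs.
  - destruct (Rtotal_order (height x) (height y)) as [H|[E'|H]].
    + destruct (Hv x y E H) as [z Hz]. exists z. now apply separates_sym.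
    + destruct Hxy. now apply comb_ext.
    + now apply Hv.
  - destruct (Hs y x H) as [z Hz]. exists z. now apply separates_sym.
Qed.

Lemma comb_arc (x y : comb P) : x <> y -> exists A, is_arc (comb P) A x y.
Proof.
  intros Hxy. destruct (joined_within_distance x y) as (g & Hg & <- & <- & _).
  destruct (path_contains_arc (comb P) g Hg Hxy) as (A & HA & _). now exists A.
Qed.

Lemma comb_valence : valence_le (comb P) 3.
Proof.
  intros z (f & Hz & Hsep). pose proof (comb_range z) as Rz.
  set (above := fun w => col w = col z /\ height z < height w).
  assert (Hsame : forall w w', joined (comb P) (fun v => v <> z) w w' -> same_comp_minus (comb P) z w w').
  { intros w w' (g & Hg & <- & <- & Hgz). exists (trace (comb P) g).
    split; [now apply trace_connected|]. split; [intros v (t & Ht & <-); auto|].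
    split; [exists 0|exists 1]; split; try lra; reflexivity. }
  assert (Hclass : exists cl : comb P -> nat, (forall w, (cl w < 3)%nat) /\
    forall w w', w <> z -> w' <> z -> cl w = cl w' -> joined (comb P) (fun v => v <> z) w w').
  (* Class 0 lies above [z] on its tooth. If [z] has positive height, all other points hang together
     through the spine; if [z] lies on the spine, they split into left and right. Four points must
     share one of these three classes. *)
  { exists (fun w => if excluded_middle_informative (above w) then O
      else if Rlt_dec 0 (height z) then 1%nat else if Rlt_dec (col w) (col z) then 1%nat else 2%nat).
    split; [intros w; repeat destruct excluded_middle_informative; repeat destruct Rlt_dec; lia|].
    intros w w' Hw Hw'. pose proof (comb_range w). pose proof (comb_range w').
    assert (Hne : forall v, v <> z -> col v = col z -> ~ above v -> height v < height z).
    { intros v Hv E N. apply Rnot_le_lt. intros [Hlt|Heq]; [now apply N|].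
      apply Hv. now apply comb_ext. }
    destruct (excluded_middle_informative (above w)) as [A|A];
      destruct (excluded_middle_informative (above w')) as [A'|A'];
      try (repeat destruct Rlt_dec; discriminate).
    - intros _. destruct A as [E A], A' as [E' A'].
      apply joined_mono with (2 := vertical_joined w w' ltac:(congruence)).
      intros v [_ Hv] ->. lra.
    - intros Hcl. apply joined_mono with (2 := through_spine_joined w w').
      specialize (Hne w Hw) as H1. specialize (Hne w' Hw') as H2.
      intros v Hv ->. destruct (Rlt_dec 0 (height z)).
      + destruct Hv as [[E ?]|[[E ?]|[E ?]]].
        * specialize (H1 (eq_sym E) A). lra.
        * specialize (H2 (eq_sym E) A'). lra.
        * lra.
      + assert (col w <> col z) by (intros E; specialize (H1 E A); lra).
        assert (col w' <> col z) by (intros E; specialize (H2 E A'); lra).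
        destruct (Rlt_dec (col w) (col z)); destruct (Rlt_dec (col w') (col z)); try discriminate;
          destruct Hv as [[? ?]|[[? ?]|[? ?]]]; lra. }
  destruct Hclass as (cl & Hcl & Hj).
  assert (Hp : forall i j, (i <= 3)%nat -> (j <= 3)%nat -> i <> j -> cl (f i) <> cl (f j)).
  { intros i j Hi Hj' Hij E. apply (Hsep i j Hi Hj' Hij). apply Hsame, Hj; auto. }
  pose proof (Hcl (f O)). pose proof (Hcl (f 1%nat)). pose proof (Hcl (f 2%nat)). pose proof (Hcl (f 3%nat)).
  pose proof (Hp O 1%nat). pose proof (Hp O 2%nat). pose proof (Hp O 3%nat).
  pose proof (Hp 1%nat 2%nat). pose proof (Hp 1%nat 3%nat). pose proof (Hp 2%nat 3%nat). lia.
Qed.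

(** Both coordinates are 1-Lipschitz and so converge. The danger is a limit of positive height off
    the teeth; it is excluded because the sequence eventually stays on one tooth. *)
Lemma comb_complete : complete (comb P).
Proof.
  intros u Hu.
  assert (Hlim : forall f : comb P -> R, (forall x y, Rabs (f x - f y) <= mdist x y) ->
    exists l, Un_cv (fun n => f (u n)) l).
  { intros f Hf. destruct (R_complete (fun n => f (u n))) as [l Hl]; [|now exists l].
    intros e He. destruct (Hu e He) as [N HN]. exists N. intros n m Hn Hm. unfold Rdist.
    apply Rle_lt_trans with (1 := Hf (u n) (u m)). now apply HN. }
  destruct (Hlim col comb_dist_ge_col) as [a Ha].
  destruct (Hlim height comb_dist_ge_height) as [s Hs]. clear Hlim.
  assert (Hr : forall n, 0 <= col (u n) <= 2 /\ 0 <= height (u n) <= col (u n))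
    by (intros n; apply comb_range).
  assert (a <= 2) by (apply (limit_le _ _ _ Ha); intros n; apply Hr).
  assert (0 <= s).
  { assert (- s <= 0); [|lra]. apply (limit_le _ _ _ (CV_opp _ _ Hs)).
    intros n. unfold opp_seq. specialize (Hr n). lra. }
  assert (s <= a).
  { assert (s - a <= 0); [|lra]. apply (limit_le _ _ _ (CV_minus _ _ _ _ Hs Ha)).
    intros n. specialize (Hr n). lra. }
  (* Points of positive height that are close to each other lie on the same tooth. *)
  assert (Htooth : 0 < s -> exists N, forall n, (N <= n)%nat -> col (u n) = a /\ P a).
  { intros Hpos. destruct (Hs (s / 2)) as [N1 HN1]; [lra|]. destruct (Hu s Hpos) as [N2 HN2].
    unfold Rdist in HN1.
    assert (Hcol : forall n m, (max N1 N2 <= n)%nat -> (max N1 N2 <= m)%nat -> col (u n) = col (u m)).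
    { intros n m Hn Hm. specialize (HN2 n m ltac:(lia) ltac:(lia)).
      pose proof (HN1 n ltac:(lia)). pose proof (HN1 m ltac:(lia)).
      destruct (comb_dist_cases (u n) (u m)) as [[E _]|[_ D]]; [assumption|].
      rewrite D in HN2. pose proof (Rabs_pos (col (u n) - col (u m))). exfalso. rabs. }
    exists (max N1 N2).
    assert (Ea : forall n, (max N1 N2 <= n)%nat -> col (u n) = a).
    { intros n Hn. apply (UL_sequence (fun m => col (u m))); [|assumption].
      intros e He. exists (max N1 N2). intros m Hm. unfold Rdist. rewrite (Hcol m n); [|lia|lia].
      now rewrite Rminus_diag, Rabs_R0. }
    intros n Hn. split; [now apply Ea|]. rewrite <- (Ea n Hn).
    destruct (comb_tooth (u n)) as [E|]; [|assumption]. exfalso.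
    specialize (HN1 n ltac:(lia)). rewrite E in HN1. rabs. }
  destruct (comb_point_coords a s) as [E1 E2]; [lra|lra| |].
  { destruct (Req_dec s 0); [now left|right]. destruct Htooth as [N HN]; [lra|]. now apply (HN N). }
  exists (comb_point a s). intros e He.
  destruct (Ha (e / 2)) as [N1 HN1]; [lra|]. destruct (Hs (e / 2)) as [N2 HN2]; [lra|].
  unfold Rdist in *.
  assert (Hcl : exists N, forall n, (N <= n)%nat -> col (u n) = a \/ s = 0).
  { destruct (Req_dec s 0); [exists O; now right|]. destruct Htooth as [N HN]; [lra|].
    exists N. intros n Hn. left. now apply HN. }
  destruct Hcl as [N3 HN3]. exists (max (max N1 N2) N3). intros n Hn.
  specialize (HN1 n ltac:(lia)). specialize (HN2 n ltac:(lia)). specialize (HN3 n ltac:(lia)).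
  specialize (Hr n).
  destruct (comb_dist_cases (u n) (comb_point a s)) as [[_ ->]|[N ->]]; rewrite ?E1, ?E2 in *.
  - lra.
  - destruct HN3; [contradiction|]. rabs.
Qed.

(** A tooth over [b] has height [b], so at scale [r] those with [b < r/8] stay within the flat cells
    along the spine and need not be counted. *)
Hypothesis teeth_sparse : exists K, forall a r, 0 <= a -> 0 < r ->
  exists l : list R, (length l <= K)%nat /\ forall b, P b -> Rabs (b - a) < r -> r / 8 <= b -> In b l.

Lemma comb_doubling : exists N, (1 <= N)%nat /\ doubling_with (comb P) N.
Proof.
  destruct teeth_sparse as [K HK]. exists (16 + S K * 8)%nat. split; [lia|].
  intros x r Hr. pose proof (comb_range x) as Rx. destruct (HK (col x) r) as (l & Hl & Hin); [lra|lra|].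
  (* A flat cell has diameter below [r/2]: two heights and a column difference, each below [r/8]; 16
     of them span the columns within [r] of [col x]. Steep cells are pieces of length [r/4] of one
     column, 8 per base: one base is the column of [x], from [height x - r] up, the others are the
     at most [K] listed teeth, from 0 up. *)
  set (flat := fun i (w : comb P) => height w < r / 8 /\
    col x - r + INR i * (r / 8) <= col w < col x - r + INR i * (r / 8) + r / 8).
  set (steep := fun (c : R * R) i (w : comb P) => col w = fst c /\
    snd c + INR i * (r / 4) <= height w < snd c + INR i * (r / 4) + r / 4).
  set (bases := (col x, height x - r) :: map (fun c => (c, 0)) l).
  destruct (cover_by_small_cells (comb P) x r
    (map flat (seq 0 16) ++ flat_map (fun c => map (steep c) (seq 0 8)) bases)) as (cs & Hcs & Hcov).
  - intros Q HQ y z. pose proof (comb_range y). pose proof (comb_range z).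
    apply in_app_or in HQ. destruct HQ as [HQ|HQ].
    + apply in_map_iff in HQ. destruct HQ as (i & <- & _). intros [? ?] [? ?].
      destruct (comb_dist_cases y z) as [[_ ->]|[_ ->]]; rabs.
    + apply in_flat_map in HQ. destruct HQ as (c & _ & HQ). apply in_map_iff in HQ.
      destruct HQ as (i & <- & _). intros [E ?] [E' ?].
      destruct (comb_dist_cases y z) as [[_ ->]|[N _]]; [rabs|congruence].
  - intros y Hy. unfold ball in Hy. pose proof (comb_range y).
    pose proof (comb_dist_ge_col x y) as Dc.
    destruct (Rlt_le_dec (height y) (r / 8)) as [Hlow|Hhigh].
    + destruct (grid_cell (col x - r) (r / 8) (col y) 16) as (i & Hi & Hc); [lra|simpl; rabs|].
      exists (flat i). split; [|now split]. apply in_or_app. left. apply in_map, in_seq. lia.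
    + assert (Hbase : exists c, In c bases /\ col y = fst c /\
        snd c <= height y < snd c + INR 8 * (r / 4)).
      { destruct (comb_dist_cases x y) as [[E D]|[E D]]; rewrite D in Hy.
        - exists (col x, height x - r). split; [now left|]. split; [now symmetry|simpl; rabs].
        - pose proof (Rabs_pos (col x - col y)). exists (col y, 0). split; [|split; [reflexivity|simpl; lra]].
          right. apply in_map_iff. exists (col y). split; [reflexivity|]. apply Hin; [|rabs|lra].
          destruct (comb_tooth y); [lra|assumption]. }
      destruct Hbase as (c & Hc & E & Hh).
      destruct (grid_cell (snd c) (r / 4) (height y) 8) as (i & Hi & Hi'); [lra|assumption|].
      exists (steep c i). split; [|now split]. apply in_or_app. right.
      apply in_flat_map. exists c. split; [assumption|]. apply in_map, in_seq. lia.
  - exists cs. split; [|assumption]. apply Nat.le_trans with (1 := Hcs).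
    rewrite length_app, length_map, length_seq, (length_flat_map_const _ _ _ 8).
    + unfold bases. simpl length. rewrite length_map. lia.
    + intros c. now rewrite length_map, length_seq.
Qed.

Lemma comb_compact : compact_set (comb P) (fun _ => True).
Proof.
  apply complete_totally_bounded_compact; [apply comb_complete|]. intros k.
  destruct comb_doubling as (N & _ & HN).
  (* The ball of radius 8 about the origin is the whole comb, and [3 + k] halvings of 8 give
     [2^-k]. *)
  destruct (doubling_iterate _ N HN (3 + k) (comb_point 0 0) 8) as (cs & _ & Hcs); [lra|].
  exists cs. intros y. destruct (Hcs y) as (c & Hc & Hb).
  - unfold ball. pose proof (comb_range y).
    destruct (comb_point_coords 0 0) as [E1 E2]; [lra|lra|now left|].
    destruct (comb_dist_cases (comb_point 0 0) y) as [[_ ->]|[_ ->]]; rewrite ?E1, ?E2; rabs.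
  - exists c. split; [assumption|]. replace ((/ 2) ^ k) with (8 * (/ 2) ^ (3 + k)); [assumption|].
    rewrite pow_add. simpl. field.
Qed.

Lemma comb_qc_tree : qc_tree (comb P).
Proof.
  split; [|split].
  - split; [apply comb_compact|]. split; [|split; [|split]].
    + apply joined_connected with (comb_point 0 0). intros y _.
      apply joined_mono with (2 := through_spine_joined (comb_point 0 0) y). auto.
    + intros x U HU Hx. destruct (HU x Hx) as (r & Hr & Hb). exists (ball (comb P) x r).
      split; [apply ball_open|]. split; [|split; [unfold ball; rewrite mdist_refl; lra|assumption]].
      apply joined_connected with x. intros y Hy.
      apply joined_mono with (2 := joined_within_distance x y).
      unfold ball in *. intros w Hw. lra.
    + exists (comb_point 0 0), (comb_point 1 0). intros E.
      destruct (comb_point_coords 0 0) as [E1 _]; [lra|lra|now left|].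
      destruct (comb_point_coords 1 0) as [E2 _]; [lra|lra|now left|].
      rewrite E in E1. lra.
    + intros x y Hxy. split; [now apply comb_arc|]. intros A B HA HB z.
      split; now apply (arc_unique_of_separation (comb P) comb_separation x y).
  - destruct comb_doubling as (N & HN1 & HN). exists N. split; [assumption|exact HN].
  - exists 2. split; [lra|]. intros x y.
    destruct (joined_within_distance x y) as (g & Hg & Hx & Hy & Hd). exists (trace (comb P) g).
    assert (Tx : trace (comb P) g x) by (exists 0; split; [lra|assumption]).
    assert (Ty : trace (comb P) g y) by (exists 1; split; [lra|assumption]).
    split; [|split; [assumption|split; [assumption|]]].
    + split; [now exists x|]. split; [now apply trace_compact|now apply trace_connected].
    + intros a b (s & Hs & <-) (t & Ht & <-).
      pose proof (Hd s Hs). pose proof (Hd t Ht).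
      pose proof (mdist_tri (comb P) (g s) x (g t)). rewrite (mdist_sym _ (g s) x) in *. lra.
Qed.

End Comb.

(** * Clusters of teeth *)

Lemma half_pow_antitone (m k : nat) : (m <= k)%nat -> (/ 2) ^ k <= (/ 2) ^ m.
Proof.
  intros H. induction H as [|k H IH]; [lra|]. simpl. assert (0 < (/ 2) ^ k) by (apply pow_lt; lra). lra.
Qed.

(* The [k]-th cluster of [n] teeth starts at [2^-k], and its width relative to [2^-k], the order
   of the tooth heights, is less than [1/(k+1)]. *)
Definition tooth_position (n k j : nat) : R := (/ 2) ^ k * (1 + INR j / (INR n * INR (S k))).

Definition clustered_teeth (n : nat) (b : R) : Prop :=
  exists k j, (j < n)%nat /\ b = tooth_position n k j.

Lemma tooth_offset (n k j : nat) : (j < n)%nat -> 0 <= INR j / (INR n * INR (S k)) < / INR (S k).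
Proof.
  intros Hj. assert (Hn : 0 < INR n) by (apply lt_0_INR; lia).
  assert (Hk : 0 < INR (S k)) by (apply lt_0_INR; lia). apply lt_INR in Hj.
  pose proof (pos_INR j). pose proof (Rinv_0_lt_compat _ Hk). split.
  - apply Rle_mult_inv_pos; [assumption|now apply Rmult_lt_0_compat].
  - apply Rmult_lt_reg_r with (INR n * INR (S k)); [now apply Rmult_lt_0_compat|].
    replace (INR j / (INR n * INR (S k)) * (INR n * INR (S k))) with (INR j) by (field; lra).
    replace (/ INR (S k) * (INR n * INR (S k))) with (INR n) by (field; lra). assumption.
Qed.

Lemma tooth_position_bounds (n k j : nat) : (j < n)%nat ->
  (/ 2) ^ k <= tooth_position n k j < 2 * (/ 2) ^ k.
Proof.
  intros Hj. pose proof (tooth_offset n k j Hj) as Ho. unfold tooth_position.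
  assert (0 < (/ 2) ^ k) by (apply pow_lt; lra).
  assert (/ INR (S k) <= 1).
  { rewrite <- Rinv_1. apply Rinv_le_contravar; [lra|]. apply (le_INR 1). lia. }
  nra.
Qed.

(** Take the least [k0] with [2^-k0 < a + r]. From [2^-k <= b < a + r] follows [k >= k0]. On the
    other side [a + r < b + 2 r <= 17 b], whereas [k >= k0 + 6] would give [b < (a + r)/32]. Six
    clusters of [n] teeth remain. *)
Lemma clustered_teeth_sparse (n : nat) : exists K, forall a r, 0 <= a -> 0 < r ->
  exists l : list R, (length l <= K)%nat /\
    forall b, clustered_teeth n b -> Rabs (b - a) < r -> r / 8 <= b -> In b l.
Proof.
  exists (6 * n)%nat. intros a r Ha Hr.
  destruct (half_pow_small (a + r)) as [k1 Hk1]; [lra|].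
  destruct (least_nat (fun k => (/ 2) ^ k < a + r) k1 Hk1) as (k0 & Hk0 & Hmin).
  exists (flat_map (fun k => map (tooth_position n k) (seq 0 n)) (seq k0 6)). split.
  - rewrite (length_flat_map_const _ _ _ n); [rewrite length_seq; lia|].
    intros k. now rewrite length_map, length_seq.
  - intros b (k & j & Hj & ->) Hab Hb. pose proof (tooth_position_bounds n k j Hj).
    apply in_flat_map. exists k. split; [|apply in_map, in_seq; lia].
    apply in_seq. split; [apply Hmin; rabs|]. apply Nat.nle_gt. intros Hge.
    apply half_pow_antitone in Hge. rewrite pow_add in Hge. simpl pow at 3 in Hge.
    assert (0 < (/ 2) ^ k0) by (apply pow_lt; lra). simpl in Hge. rabs.
Qed.

Lemma tooth_position_inj (n k i j : nat) : (i < n)%nat ->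
  tooth_position n k i = tooth_position n k j -> i = j.
Proof.
  intros Hi E. assert (Hn : 0 < INR n) by (apply lt_0_INR; lia).
  assert (Hk : 0 < INR (S k)) by (apply lt_0_INR; lia).
  unfold tooth_position in E. apply Rmult_eq_reg_l in E; [|apply pow_nonzero; lra].
  apply INR_eq. apply Rplus_eq_reg_l in E.
  apply (f_equal (fun x => x * (INR n * INR (S k)))) in E.
  field_simplify in E; [assumption|lra|lra].
Qed.

Lemma tooth_cluster_narrow (n : nat) (eps : R) : 0 < eps ->
  exists k, forall j, (j < n)%nat ->
    0 <= tooth_position n k j - tooth_position n k 0 <= eps * tooth_position n k 0.
Proof.
  intros He. destruct (archimed_cor1 eps He) as [k [Hk Hk0]].
  destruct k as [|k]; [lia|]. exists k. intros j Hj. pose proof (tooth_offset n k j Hj).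
  assert (0 < (/ 2) ^ k) by (apply pow_lt; lra).
  unfold tooth_position. replace (INR 0 / (INR n * INR (S k))) with 0 by (unfold Rdiv; simpl; ring).
  nra.
Qed.

(** * The image of a tight cluster under an embedding *)

Lemma finite_argmin (d : nat -> R) (n : nat) : (0 < n)%nat ->
  exists i, (i < n)%nat /\ forall j, (j < n)%nat -> d i <= d j.
Proof.
  intros Hn. induction n as [|n IH]; [lia|]. destruct (Nat.eq_dec n 0) as [->|].
  - exists O. split; [lia|]. intros j Hj. replace j with O by lia. lra.
  - destruct IH as (i & Hi & Hmin); [lia|]. destruct (Rle_lt_dec (d i) (d n)).
    + exists i. split; [lia|]. intros j Hj. destruct (Nat.eq_dec j n) as [->|]; [assumption|].
      apply Hmin. lia.
    + exists n. split; [lia|]. intros j Hj. destruct (Nat.eq_dec j n) as [->|]; [lra|].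
      apply Rle_trans with (d i); [lra|]. apply Hmin. lia.
Qed.

Lemma arc_image (X Y : MetricSpace) (f : X -> Y) (A : X -> Prop) (x y : X) :
  qs_embedding X Y f -> is_arc X A x y ->
  is_arc Y (fun z => exists w, A w /\ f w = z) (f x) (f y).
Proof.
  intros (Hinj & Hf & Hfinv & _) (g & <- & <- & HA & Hg & Hc & Hcinv).
  exists (fun t => f (g t)). split; [reflexivity|]. split; [reflexivity|].
  split; [|split; [|split]].
  - intros z. split.
    + intros (w & Hw & <-). apply HA in Hw. destruct Hw as (t & Ht & <-). now exists t.
    + intros (t & Ht & <-). exists (g t). split; [apply HA; now exists t|reflexivity].
  - intros s t Hs Ht E. now apply Hg, Hinj.
  - intros t eps Ht He. destruct (Hf (g t) eps He) as (d & Hd & H).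
    destruct (Hc t d Ht Hd) as (d' & Hd' & H'). exists d'. split; [assumption|].
    intros s Hs Hst. rewrite mdist_sym. apply H. rewrite mdist_sym. now apply H'.
  - intros t eps Ht He. destruct (Hcinv t eps Ht He) as (d & Hd & H).
    destruct (Hfinv (g t) d Hd) as (d' & Hd' & H'). exists d'. split; [assumption|].
    intros s Hs Hst. apply H; [assumption|]. rewrite mdist_sym. apply H'. now rewrite mdist_sym.
Qed.

Lemma spine_dist (P : R -> Prop) (a b : R) : 0 <= a <= 2 -> 0 <= b <= 2 ->
  mdist (comb_point P a 0) (comb_point P b 0) = Rabs (a - b).
Proof.
  intros Ha Hb. destruct (comb_point_coords P a 0) as [E1 E2]; [lra|lra|now left|].
  destruct (comb_point_coords P b 0) as [E3 E4]; [lra|lra|now left|].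
  destruct (comb_dist_cases P (comb_point P a 0) (comb_point P b 0)) as [[E ->]|[_ ->]];
    rewrite E2, E4; [|rewrite E1, E3; lra].
  rewrite E1, E3 in E. rewrite E. f_equal. lra.
Qed.

(** [homeo_nonneg] does not state the value at 0. A zero [t > 0] is impossible: two spine points
    have distances to the origin in ratio [t], and the ratio of their image distances, which is
    positive, would be at most 0. *)
Lemma comb_modulus_zero (P : R -> Prop) (T : MetricSpace) (f : comb P -> T) (eta : R -> R) :
  (forall x y, f x = f y -> x = y) -> homeo_nonneg eta ->
  (forall x a b : comb P, x <> b ->
     mdist (f x) (f a) / mdist (f x) (f b) <= eta (mdist x a / mdist x b)) ->
  eta 0 = 0.
Proof.
  intros Hinj (_ & _ & Hsurj & _) Hqs. destruct (Hsurj 0 (Rle_refl 0)) as (t & [Ht|<-] & E); [|assumption].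
  exfalso.
  assert (H : forall a b, 0 < a <= 2 -> 0 < b <= 2 -> a / b <> t).
  { intros a b Ha Hb Hab.
    assert (Hne : forall c, 0 < c <= 2 -> f (comb_point P 0 0) <> f (comb_point P c 0)).
    { intros c Hc E'. apply Hinj in E'. pose proof (spine_dist P 0 c ltac:(lra) ltac:(lra)) as D.
      rewrite E', mdist_refl in D. rabs. }
    specialize (Hqs (comb_point P 0 0) (comb_point P a 0) (comb_point P b 0)).
    rewrite !spine_dist in Hqs by lra.
    replace (Rabs (0 - a) / Rabs (0 - b)) with t in Hqs.
    2:{ rewrite <- Hab. f_equal; [|f_equal]; rabs. }
    pose proof (mdist_gt0 T _ _ (Hne a Ha)) as Da. pose proof (mdist_gt0 T _ _ (Hne b Hb)) as Db.
    pose proof (Rdiv_lt_0_compat _ _ Da Db).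
    assert (comb_point P 0 0 <> comb_point P b 0) by (intros E'; apply (Hne b Hb); now rewrite E').
    specialize (Hqs ltac:(assumption)). lra. }
  (* The larger of the two distances is taken to be 1, which keeps both points on the spine. *)
  destruct (Rle_lt_dec t 1).
  - apply (H t 1); [lra|lra|field].
  - apply (H 1 (/ t)); [lra| |field; lra]. split; [now apply Rinv_0_lt_compat|].
    apply Rmult_le_reg_r with t; [lra|]. rewrite Rinv_l; lra.
Qed.

Theorem theorem1p1 :
  ~ exists T : MetricSpace,
      qc_tree T /\
      forall X : MetricSpace, qc_tree X -> valence_le X 3 ->
        exists f : X -> T, qs_embedding X T f.
Proof.
  intros (T & (Htree & (N & HN1 & HN) & (C & HC & HT)) & Huniv).
  (* The points [f (u j)] found below lie in a ball of radius [2 s] and are at least [3 s/(8 C)]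
     apart, while [2 (2 s) 2^-m < s/(4 C)]. So [n] exceeds by one the number that doubling
     allows. *)
  destruct (half_pow_small (/ (16 * C))) as [m Hm]; [apply Rinv_0_lt_compat; lra|].
  set (n := S (N ^ m)). set (P := clustered_teeth n).
  destruct (Huniv (comb P)) as [f Hf]; [apply comb_qc_tree, clustered_teeth_sparse|apply comb_valence|].
  pose proof Hf as (Hinj & Hcont & _ & eta & Heta & Hqs).
  pose proof (comb_modulus_zero P T f eta Hinj Heta Hqs) as Heta0.
  destruct Heta as (_ & _ & _ & Hetac & _).
  destruct (Hetac 0 (1 / 4)) as (delta & Hdelta & Hsmall); [lra|lra|].
  destruct (tooth_cluster_narrow n (delta / 2)) as [k Hk]; [lra|].
  set (p := tooth_position n k) in *.
  assert (Hp : forall j, (j < n)%nat -> 0 < p j <= 2 /\ P (p j)).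
  { intros j Hj. pose proof (tooth_position_bounds n k j Hj).
    pose proof (half_pow_antitone 0 k ltac:(lia)) as H1. simpl in H1.
    assert (0 < (/ 2) ^ k) by (apply pow_lt; lra).
    split; [unfold p; lra|]. now exists k, j. }
  set (c := fun j => comb_point P (p j) 0). set (tip := fun j => comb_point P (p j) (p j)).
  assert (Hc : forall j, (j < n)%nat -> col P (c j) = p j /\ height P (c j) = 0).
  { intros j Hj. destruct (Hp j Hj). apply comb_point_coords; [lra|lra|now left]. }
  assert (Htip : forall j, (j < n)%nat -> col P (tip j) = p j /\ height P (tip j) = p j).
  { intros j Hj. destruct (Hp j Hj). apply comb_point_coords; [lra|lra|now right]. }
  assert (H0n : (0 < n)%nat) by (unfold n; lia).
  assert (Hot : forall j, (j < n)%nat -> p O <= mdist (c O) (tip j)).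
  { intros j Hj. pose proof (comb_dist_ge_height P (c O) (tip j)) as D.
    destruct (Hc O H0n) as [_ E], (Htip j Hj) as [_ E']. rewrite E, E' in D.
    specialize (Hk j Hj). destruct (Hp j Hj). rabs. }
  (* With [s] the least distance from [f (c O)] to the image of a tip, the image of every tooth
     reaches distance [s]; applied with the minimising tip [i0] in the denominator, the modulus
     bounds the distances between feet by a fraction of [s]. *)
  destruct (finite_argmin (fun j => mdist (f (c O)) (f (tip j))) n H0n) as (i0 & Hi0 & Hmin).
  set (s := mdist (f (c O)) (f (tip i0))) in *.
  assert (Hs : 0 < s).
  { apply mdist_gt0. intros E. apply Hinj in E. specialize (Hot i0 Hi0).
    rewrite E, mdist_refl in Hot. destruct (Hp O H0n). lra. }
  assert (Hbase : forall j, (j < n)%nat -> mdist (f (c O)) (f (c j)) <= s / 4).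
  { intros j Hj. specialize (Hot i0 Hi0). destruct (Hp O H0n) as [Hp0 _]. destruct (Hp j Hj) as [Hpj _].
    specialize (Hk j Hj).
    assert (Hne : c O <> tip i0) by (intros E; rewrite E, mdist_refl in Hot; lra).
    specialize (Hqs (c O) (c j) (tip i0) Hne). fold s in Hqs.
    assert (Hratio : 0 <= mdist (c O) (c j) / mdist (c O) (tip i0) < delta).
    { split; [apply Rle_mult_inv_pos; [apply mdist_pos|lra]|].
      apply Rmult_lt_reg_r with (mdist (c O) (tip i0)); [lra|].
      unfold Rdiv. rewrite Rmult_assoc, Rinv_l, Rmult_1_r by lra.
      unfold c at 1 2. rewrite spine_dist by lra.
      apply Rle_lt_trans with (delta / 2 * p O); [rabs|]. nra. }
    specialize (Hsmall (mdist (c O) (c j) / mdist (c O) (tip i0)) ltac:(lra) ltac:(rabs)).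
    rewrite Heta0 in Hsmall.
    assert (H4 : mdist (f (c O)) (f (c j)) / s < 1 / 4) by rabs.
    apply Rmult_lt_compat_r with (r := s) in H4; [|assumption].
    replace (mdist (f (c O)) (f (c j)) / s * s) with (mdist (f (c O)) (f (c j))) in H4 by (field; lra).
    lra. }
  (* The distance from [f (c O)] is at most [s/4] at the foot and at least [s] at the tip, so it
     equals [s] somewhere on each tooth. *)
  assert (Hlevel : forall j, exists u : comb P, (j < n)%nat ->
      col P u = p j /\ mdist (f (c O)) (f u) = s).
  { intros j. destruct (lt_dec j n) as [Hj|Hj]; [|exists (c O); contradiction].
    destruct (Hc j Hj) as [C1 C2]. destruct (Htip j Hj) as [T1 T2].
    assert (E : col P (c j) = col P (tip j)) by congruence.
    set (g := fun u => comb_point P (col P (c j)) (height P (c j) + u * (height P (tip j) - height P (c j)))).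
    destruct (path_ivt (fun u => mdist (f (c O)) (f (g u))) s) as (u & Hu & Hus).
    - intros t eps Ht He. destruct (Hcont (g t) eps He) as (d & Hd & Hfd).
      destruct (vertical_path P (c j) (tip j) E t d Ht Hd) as (d' & Hd' & H).
      exists d'. split; [assumption|]. intros v Hv Hvt. specialize (H v Hv Hvt).
      rewrite mdist_sym in H. specialize (Hfd (g v) H). simpl.
      pose proof (mdist_tri T (f (c O)) (f (g t)) (f (g v))).
      pose proof (mdist_tri T (f (c O)) (f (g v)) (f (g t))).
      rewrite (mdist_sym T (f (g v)) (f (g t))) in *. rabs.
    - replace (g 0) with (c j) by (unfold g; rewrite Rmult_0_l, Rplus_0_r; now rewrite comb_point_eta).
      replace (g 1) with (tip j).
      + split; [specialize (Hbase j Hj); lra|now apply Hmin].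
      + unfold g. rewrite E, C2, Rmult_1_l, Rplus_0_l, Rminus_0_r. now rewrite comb_point_eta.
    - exists (g u). intros _. split; [|assumption].
      destruct (vertical_coords P (c j) (tip j) u E Hu) as [E1 _]. unfold g. now rewrite E1. }
  apply choice in Hlevel. destruct Hlevel as [u Hu].
  assert (Hfar : forall j, (j < n)%nat -> 3 / 4 * s <= mdist (f (u j)) (f (c j))).
  { intros j Hj. destruct (Hu j Hj) as [_ E]. specialize (Hbase j Hj).
    pose proof (mdist_tri T (f (c O)) (f (c j)) (f (u j))). rewrite (mdist_sym T (f (u j))). lra. }
  assert (n <= N ^ m)%nat; [|unfold n in *; lia].
  apply (separated_points_bound T N m n (f (c O)) (2 * s) (fun j => f (u j)) HN); [lra| |].
  - intros j Hj. unfold ball. destruct (Hu j Hj) as [_ ->]. lra.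
  - intros i j Hij. assert (Hi : (i < n)%nat) by lia. assert (Hj : (j < n)%nat) by lia.
    destruct (Hu i Hi) as [Ci _], (Hu j Hj) as [Cj _], (Hc i Hi) as [Cc Hcc].
    assert (Hpij : p i <> p j) by (intros E; apply tooth_position_inj in E; lia).
    specialize (Hfar i Hi).
    (* [u i] is not the foot [c i], as their images are far apart. The foot therefore cuts [u i] off
       from the other teeth, and every arc from [u i] to [u j] passes through [c i]. *)
    assert (Hsep : separates (comb P) (c i) (u i) (u j)).
    { apply separates_above.
      - congruence.
      - rewrite Hcc. pose proof (comb_range P (u i)).
        destruct (Req_dec (height P (u i)) 0) as [E|]; [|lra].
        replace (u i) with (c i) in Hfar by (apply comb_ext; congruence).
        rewrite mdist_refl in Hfar. lra.
      - intros [E _]. congruence. }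
    assert (Huij : u i <> u j) by (intros E; rewrite E in Ci; congruence).
    destruct (comb_arc P (u i) (u j) Huij) as [A HA].
    assert (HcA : A (c i)).
    { destruct (arc_path _ _ _ _ HA) as (g & Hg & E0 & E1 & HAg & _). apply HAg.
      apply separates_path; [assumption|]. now rewrite E0, E1. }
    (* By uniqueness the image of the comb arc is the arc of [T]. It contains [f (c i)], at least
       [3 s/4] away from [f (u i)], so its ends cannot be close. *)
    assert (Harc : mdist (f (u i)) (f (c i)) <= 2 * C * mdist (f (u i)) (f (u j))).
    { apply (arc_diameter T N C Htree HN1 HN HC HT) with (fun z => exists w, A w /\ f w = z).
      - intros E. now apply Huij, Hinj.
      - now apply arc_image.
      - now exists (c i). }
    apply Rmult_lt_compat_r with (r := 16 * C) in Hm; [|lra]. rewrite Rinv_l in Hm by lra.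
    apply Rmult_le_reg_l with (2 * C); [lra|]. nra.
Qed.
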